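(* Let $K$ be an algebraically closed field of characteristic zero and let $h=(1,h_1,h_2,h_3,1)$ be a Gorenstein O-sequence with $h_2\ge h_1$. Then every Artinian Gorenstein local $K$-algebra with Hilbert function $h$ is canonically graded if and only if $h_1=h_3$ and $h_2=\binom{h_1+1}{2}$.
   Context: $K$ is an algebraically closed field of characteristic zero. An Artinian local $K$-algebra is a ring $A=R/I$ of finite $K$-dimension, where $R=K[[x_1,\dots,x_r]]$ is a formal power series ring and $I$ is a proper ideal of $R$ (Artinian standard graded $K$-algebras are a special case); $\mathfrak m$ denotes its maximal ideal. Its Hilbert function (or $h$-vector) is $h=(h_0,h_1,\dots,h_s)$ with $h_i=\dim_K \mathfrak m^i/\mathfrak m^{i+1}$, where the socle degree $s$ is the largest integer $j$ with $\mathfrak m^j\neq 0$. $A$ is Gorenstein if $\dim_K(0:\mathfrak m)=1$. A sequence of positive integers $h=(1,h_1,\dots,h_s)$ is a Gorenstein O-sequence if it is the Hilbert function of some Artinian Gorenstein local $K$-algebra (not required to be graded). An Artinian local $K$-algebra $(A,\mathfrak m)$ is canonically graded if there exists a $K$-algebra isomorphism between $A$ and its associated graded ring $gr_{\mathfrak m}(A)=\bigoplus_{i\ge 0}\mathfrak m^i/\mathfrak m^{i+1}$. *)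

(* Defs.v *)
From HB Require Import structures.
From mathcomp Require Import all_boot all_algebra.
From mathcomp Require Import generic_quotient ring_quotient falgebra.
From mathcomp.classical Require Import boolp.
From mathcomp.multinomials Require Import mpoly.

Set Implicit Arguments.
Unset Strict Implicit.
Unset Printing Implicit Defensive.

Import GRing.Theory.
Local Open Scope ring_scope.

(* Formal power series in r variables: arbitrary families of coefficients
   indexed by the monomials 'X_{1..r}. *)
Record powser (r : nat) (R : comNzRingType) :=
  PowSer { pscoef : 'X_{1..r} -> R }.

Section PowerSeries.
Variables (r : nat) (R : comNzRingType).
Implicit Types (f g h : powser r R) (m : 'X_{1..r}).

HB.instance Definition _ := gen_eqMixin (powser r R).
HB.instance Definition _ := gen_choiceMixin (powser r R).

Lemma psP f g : pscoef f =1 pscoef g -> f = g.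
Proof. by case: f g => [f] [g] /= /funext ->. Qed.

Definition ps0 : powser r R := PowSer (fun _ => 0).
Definition psopp f : powser r R := PowSer (fun m => - pscoef f m).
Definition psadd f g : powser r R :=
  PowSer (fun m => pscoef f m + pscoef g m).
Definition ps1 : powser r R := PowSer (fun m => (m == 0%MM)%:R).
Definition psscale (c : R) f : powser r R := PowSer (fun m => c * pscoef f m).
(* The Cauchy product. The bounds on the degrees of k.1 and k.2 only serve to
   make the index type finite: they follow from m = k.1 + k.2. *)
Definition psmul f g : powser r R :=
  PowSer (fun m =>
    \sum_(k : 'X_{1..r < (mdeg m).+1, (mdeg m).+1} | m == (k.1 + k.2)%MM)
      pscoef f k.1 * pscoef g k.2).

Lemma psaddA : associative psadd.
Proof. by move=> f g h; apply: psP => m /=; rewrite addrA. Qed.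
Lemma psaddC : commutative psadd.
Proof. by move=> f g; apply: psP => m /=; rewrite addrC. Qed.
Lemma ps0add : left_id ps0 psadd.
Proof. by move=> f; apply: psP => m /=; rewrite add0r. Qed.
Lemma psaddN : left_inverse ps0 psopp psadd.
Proof. by move=> f; apply: psP => m /=; rewrite addNr. Qed.

HB.instance Definition _ :=
  GRing.isZmodule.Build (powser r R) psaddA psaddC ps0add psaddN.

Definition pstrunc (d : nat) f : {mpoly R[r]} :=
  \sum_(m : 'X_{1..r < d}) pscoef f m *: 'X_[m].

Lemma pstruncE d f m : (mdeg m < d)%N -> (pstrunc d f)@_m = pscoef f m.
Proof. exact: mcoeff_mpoly. Qed.

Lemma psmulE_mpoly f g (p q : {mpoly R[r]}) m :
    (forall k, (mdeg k <= mdeg m)%N -> p@_k = pscoef f k) ->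
    (forall k, (mdeg k <= mdeg m)%N -> q@_k = pscoef g k) ->
  pscoef (psmul f g) m = (p * q)@_m.
Proof.
move=> pf qg; rewrite mcoeffM /=; apply: eq_bigr => k _.
by rewrite pf ?qg // -ltnS bmdeg.
Qed.

Lemma psmulE d f g m : (mdeg m < d)%N ->
  pscoef (psmul f g) m = (pstrunc d f * pstrunc d g)@_m.
Proof.
by move=> md; apply: psmulE_mpoly => k km; rewrite pstruncE // (leq_ltn_trans km).
Qed.

Lemma psmulA : associative psmul.
Proof.
move=> f g h; apply: psP => m; pose d := (mdeg m).+1.
rewrite (@psmulE_mpoly _ _ (pstrunc d f) (pstrunc d g * pstrunc d h)).
- rewrite mulrA; symmetry.
  apply: psmulE_mpoly => k km; last by rewrite pstruncE.
  by rewrite (@psmulE d).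
- by move=> k km; rewrite pstruncE.
- by move=> k km; rewrite (@psmulE d).
Qed.

Lemma psmulC : commutative psmul.
Proof. by move=> f g; apply: psP => m; rewrite !(@psmulE _ _ _ _ (ltnSn _)) mulrC. Qed.

Lemma ps1mul : left_id ps1 psmul.
Proof.
move=> f; apply: psP => m; pose d := (mdeg m).+1.
rewrite (@psmulE_mpoly _ _ 1 (pstrunc d f)) ?mul1r ?pstruncE //.
- by move=> k _; rewrite mcoeff1.
- by move=> k km; rewrite pstruncE.
Qed.

Lemma psmulDl : left_distributive psmul psadd.
Proof.
move=> f g h; apply: psP => m /=; rewrite -big_split /=.
by apply: eq_bigr => k _; rewrite mulrDl.
Qed.

Lemma ps1_neq0 : ps1 != 0.
Proof.
apply/eqP => /(congr1 (fun f => pscoef f 0%MM)) /= /eqP.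
by rewrite eqxx oner_eq0.
Qed.

HB.instance Definition _ := GRing.Zmodule_isComNzRing.Build (powser r R)
  psmulA psmulC ps1mul psmulDl ps1_neq0.

Lemma psscaleA a b f : psscale a (psscale b f) = psscale (a * b) f.
Proof. by apply: psP => m /=; rewrite mulrA. Qed.
Lemma psscale1 : left_id 1 psscale.
Proof. by move=> f; apply: psP => m /=; rewrite mul1r. Qed.
Lemma psscaleDr : right_distributive psscale +%R.
Proof. by move=> a f g; apply: psP => m /=; rewrite mulrDr. Qed.
Lemma psscaleDl f : {morph psscale^~ f : a b / a + b}.
Proof. by move=> a b; apply: psP => m /=; rewrite mulrDl. Qed.

HB.instance Definition _ := GRing.Zmodule_isLmodule.Build R (powser r R)
  psscaleA psscale1 psscaleDr psscaleDl.

Lemma psscaleAl (a : R) f g : a *: (f * g) = (a *: f) * g.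
Proof.
apply: psP => m /=; rewrite mulr_sumr; apply: eq_bigr => k _.
by rewrite mulrA.
Qed.

HB.instance Definition _ :=
  GRing.Lmodule_isLalgebra.Build R (powser r R) psscaleAl.
HB.instance Definition _ := GRing.Lalgebra_isComAlgebra.Build R (powser r R).

End PowerSeries.

#[short(type="comFalgType")]
HB.structure Definition ComFalgebra (R : nzRingType) :=
  { A of Vector R A & GRing.ComUnitAlgebra R A }.

Section LocalAlgebra.
Variables (K : fieldType) (A : comFalgType K).
Implicit Types m J : {vspace A}.

(* A is isomorphic to R/I with R = K[[x_1,...,x_r]] and I an ideal of R, the
   kernel of f. Finiteness of the dimension and properness of I are part of
   the type of A (whose elements 0 and 1 differ). *)
Definition artinian_local : Prop :=
  exists (r : nat) (f : {lrmorphism powser r K -> A}),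
    forall a : A, exists p, f p = a.

(* Every ideal of A is a K-subspace. *)
Definition is_ideal J : Prop := forall a x : A, x \in J -> a * x \in J.

Definition is_maximal_ideal m : Prop :=
  [/\ is_ideal m, m <> fullv
    & forall J, is_ideal J -> (m <= J)%VS -> J = m \/ J = fullv].

(* The i-th power of the ideal m. In the library m ^+ 0 is the line K.1, and
   not A; the factor fullv (the whole of A) restores m^0 = A and is harmless
   for i > 0. *)
Definition ideal_pow m (i : nat) : {vspace A} := (fullv * m ^+ i)%VS.

(* dim_K (m^i / m^(i+1)); the subtraction never truncates, by ideal_powS. *)
Definition hilb m (i : nat) : nat :=
  (\dim (ideal_pow m i) - \dim (ideal_pow m i.+1))%N.

Definition is_socle_degree m (s : nat) : Prop :=
  ideal_pow m s <> 0%VS /\ forall j, ideal_pow m j <> 0%VS -> (j <= s)%N.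

Definition hilbert_function m (h : seq nat) : Prop :=
  exists2 s, is_socle_degree m s & h = mkseq (hilb m) s.+1.

(* The ideal (0 : J), see annihilatorP. *)
Definition annihilator J : {vspace A} :=
  (\bigcap_(i < \dim J) lker (amulr (vbasis J)`_i))%VS.

Lemma annihilatorP J (a : A) :
  reflect (forall x, x \in J -> a * x = 0) (a \in annihilator J).
Proof.
apply: (iffP idP) => [/subv_bigcapP aJ x xJ | aJ].
  rewrite (coord_vbasis xJ) mulr_sumr big1 // => i _.
  have := aJ i isT; rewrite -memvE memv_ker lfunE /= => /eqP ax0.
  by rewrite -scalerAr ax0 scaler0.
apply/subv_bigcapP => i _; rewrite -memvE memv_ker lfunE /=.
by rewrite aJ // vbasis_mem // mem_nth // size_tuple.
Qed.

Definition gorenstein m : Prop := \dim (annihilator m) = 1%N.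

End LocalAlgebra.

(* The associated graded ring of A with respect to m. The direct sum of the
   m^i is realized as the subring rees m of A[t] made of the polynomials whose
   coefficient of t^i is in m^i for all i (the Rees algebra). The polynomials
   whose coefficient of t^i is in m^(i+1) for all i form an ideal of rees m,
   namely the direct sum of the m^(i+1), and gr m is the quotient ring: as a
   K-space it is the direct sum of the m^i / m^(i+1), and the class of a in
   degree i times the class of b in degree j is the class of a * b in degree
   i + j. *)
Section AssociatedGraded.
Variables (K : fieldType) (A : comFalgType K) (m : {vspace A}).

Definition rees_pred : {pred {poly A}} :=
  fun p => [forall i : 'I_(size p), p`_i \in ideal_pow m i].

Lemma rees_predP (p : {poly A}) :
  reflect (forall i, p`_i \in ideal_pow m i) (p \in rees_pred).
Proof.
apply: (iffP forallP) => pm i; last exact: pm.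
have [ip | pi] := ltnP i (size p); first exact: (pm (Ordinal ip)).
by rewrite nth_default // mem0v.
Qed.

Lemma mem_ideal_powM i j (a b : A) :
  a \in ideal_pow m i -> b \in ideal_pow m j -> a * b \in ideal_pow m (i + j).
Proof.
move=> ai bj; have := memv_mul ai bj; apply: subvP.
have prodC (U V : {vspace A}) : (U * V)%VS = (V * U)%VS.
  by apply: subv_anti; apply/andP; split; apply/prodvP => u v uU vV;
    rewrite mulrC memv_mul.
rewrite /ideal_pow expvD -prodvA [(m ^+ i * _)%VS]prodvA.
by rewrite [(m ^+ i * _)%VS]prodC -!prodvA prodvA prodvSl ?subvf.
Qed.

Lemma mem_ideal_pow0 (a : A) : a \in ideal_pow m 0.
Proof. by rewrite /ideal_pow expv0 prodv1 memvf. Qed.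

Lemma ideal_powS i : (ideal_pow m i.+1 <= ideal_pow m i)%VS.
Proof. by rewrite /ideal_pow expvSl prodvA prodvSl ?subvf. Qed.

Fact rees_pred_subalg : subalg_closed rees_pred.
Proof.
split=> [|a p q|p q].
- apply/rees_predP => i; rewrite coef1.
  by case: i => [|i] /=; [exact: mem_ideal_pow0 | exact: mem0v].
- move=> /rees_predP pm /rees_predP qm; apply/rees_predP => i.
  by rewrite coefD coefZ memvD // (@mem_ideal_powM 0) ?mem_ideal_pow0.
- move=> /rees_predP pm /rees_predP qm; apply/rees_predP => i.
  rewrite coefM memv_suml // => j _.
  by have := mem_ideal_powM (pm j) (qm (i - j)%N); rewrite subnKC // -ltnS.
Qed.
HB.instance Definition _ := GRing.isSubalgClosed.Build A {poly A} rees_pred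
  (GRing.subalg_closed_semi rees_pred_subalg).

Record rees := Rees { rees_val :> {poly A}; _ : rees_val \in rees_pred }.

HB.instance Definition _ := [isSub for rees_val].
HB.instance Definition _ := [Choice of rees by <:].
HB.instance Definition _ := [SubChoice_isSubComNzRing of rees by <:].
HB.instance Definition _ := [SubZmodule_isSubLmodule of rees by <:].
HB.instance Definition _ := [SubNzRing_SubLmodule_isSubLalgebra of rees by <:].

Lemma rees_val0 : rees_val 0 = 0. Proof. by []. Qed.
Lemma rees_valB (p q : rees) : rees_val (p - q) = rees_val p - rees_val q.
Proof. by []. Qed.
Lemma rees_valM (p q : rees) : rees_val (p * q) = rees_val p * rees_val q.
Proof. by []. Qed.

Lemma rees_coef (p : rees) i : (rees_val p)`_i \in ideal_pow m i.
Proof. by have /rees_predP := valP p; apply. Qed.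

Definition rees_ideal : {pred rees} :=
  fun p => [forall i : 'I_(size (rees_val p)),
              (rees_val p)`_i \in ideal_pow m i.+1].

Lemma rees_idealP p :
  reflect (forall i, (rees_val p)`_i \in ideal_pow m i.+1) (p \in rees_ideal).
Proof.
apply: (iffP forallP) => pm i; last exact: pm.
have [ip | pi] := ltnP i (size (rees_val p)); first exact: (pm (Ordinal ip)).
by rewrite nth_default // mem0v.
Qed.

Fact rees_ideal_zmod : zmod_closed rees_ideal.
Proof.
split=> [|p q /rees_idealP pm /rees_idealP qm]; apply/rees_idealP => i.
  by rewrite rees_val0 coef0 mem0v.
by rewrite rees_valB coefB memvB.
Qed.
HB.instance Definition _ := GRing.isZmodClosed.Build rees rees_ideal
  rees_ideal_zmod.

Lemma rees_idealM (p q : rees) : q \in rees_ideal -> p * q \in rees_ideal.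
Proof.
move=> /rees_idealP qm; apply/rees_idealP => i.
rewrite rees_valM coefM memv_suml // => j _.
have := mem_ideal_powM (rees_coef p j) (qm (i - j)%N).
by rewrite addnS subnKC // -ltnS.
Qed.

Lemma rees_idealZ (a : A) (q : rees) : q \in rees_ideal -> a *: q \in rees_ideal.
Proof. by move=> qI; rewrite -[q]mul1r scalerAl rees_idealM. Qed.

Definition gr := {ideal_quot rees_ideal}.

HB.instance Definition _ := GRing.Zmodule.on gr.
HB.instance Definition _ := EqQuotient.on gr.

Definition gr_one : gr := \pi_gr%qT 1.
Definition gr_mul (x y : gr) : gr := \pi_gr%qT (repr x * repr y).
Definition gr_scale (k : K) (x : gr) : gr := \pi_gr%qT (k%:A *: repr x).

Lemma gr_eqP (p q : rees) :
  reflect (\pi_gr%qT p = \pi_gr%qT q) (p - q \in rees_ideal).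
Proof. by rewrite Quotient.idealrBE; apply: eqP. Qed.

Lemma gr_addE (p q : rees) : \pi_gr%qT (p + q) = \pi_gr%qT p + \pi_gr%qT q.
Proof. exact: raddfD. Qed.

Lemma repr_gr (p : rees) : p - repr (\pi_gr%qT p) \in rees_ideal.
Proof. by apply/gr_eqP; rewrite reprK. Qed.

Lemma gr_mulE (p q : rees) : gr_mul (\pi_gr%qT p) (\pi_gr%qT q) = \pi_gr%qT (p * q).
Proof.
symmetry; apply/gr_eqP; set p' := repr _; set q' := repr _.
have -> : p * q - p' * q' = q * (p - p') + p' * (q - q').
  by rewrite !mulrBr addrA [q * p]mulrC [q * p']mulrC subrK.
by rewrite rpredD // rees_idealM // repr_gr.
Qed.

Lemma gr_scaleE (k : K) (p : rees) :
  gr_scale k (\pi_gr%qT p) = \pi_gr%qT (k%:A *: p).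
Proof.
symmetry; apply/gr_eqP; rewrite -scalerBr.
by rewrite rees_idealZ // repr_gr.
Qed.

Lemma gr_mulA : associative gr_mul.
Proof.
elim/quotW=> x; elim/quotW=> y; elim/quotW=> z.
by rewrite (gr_mulE y z) (gr_mulE x y) (gr_mulE x) (gr_mulE _ z) mulrA.
Qed.
Lemma gr_mulC : commutative gr_mul.
Proof. by elim/quotW=> x; elim/quotW=> y; rewrite !gr_mulE mulrC. Qed.
Lemma gr_mul1 : left_id gr_one gr_mul.
Proof. by elim/quotW=> x; rewrite gr_mulE mul1r. Qed.
Lemma gr_mulDl : left_distributive gr_mul +%R.
Proof.
elim/quotW=> x; elim/quotW=> y; elim/quotW=> z.
by rewrite -gr_addE (gr_mulE x z) (gr_mulE y z) gr_mulE -gr_addE mulrDl.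
Qed.
HB.instance Definition _ := GRing.Zmodule_isComPzRing.Build gr
  gr_mulA gr_mulC gr_mul1 gr_mulDl.

Lemma gr_scaleA a b (x : gr) : gr_scale a (gr_scale b x) = gr_scale (a * b) x.
Proof.
elim/quotW: x => x.
by rewrite (gr_scaleE b x) (gr_scaleE a) (gr_scaleE _ x) scalerA -scalerAl mul1r scalerA.
Qed.
Lemma gr_scale1 : left_id 1 gr_scale.
Proof. by elim/quotW=> x; rewrite gr_scaleE !scale1r. Qed.
Lemma gr_scaleDr : right_distributive gr_scale +%R.
Proof.
move=> a; elim/quotW=> x; elim/quotW=> y.
by rewrite -gr_addE (gr_scaleE a x) (gr_scaleE a y) gr_scaleE -gr_addE scalerDr.
Qed.
Lemma gr_scaleDl (x : gr) : {morph gr_scale^~ x : a b / a + b}.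
Proof.
by elim/quotW: x => x a b; rewrite (gr_scaleE a x) (gr_scaleE b x) gr_scaleE -gr_addE !scalerDl.
Qed.
HB.instance Definition _ := GRing.Zmodule_isLmodule.Build K gr
  gr_scaleA gr_scale1 gr_scaleDr gr_scaleDl.

Lemma gr_scaleAl (a : K) (x y : gr) : a *: (x * y) = (a *: x) * y.
Proof.
elim/quotW: x => x; elim/quotW: y => y.
rewrite -![_ * _]/(gr_mul _ _) -![_ *: _]/(gr_scale _ _).
by rewrite (gr_mulE x y) (gr_scaleE a x) (gr_mulE _ y) gr_scaleE scalerAl.
Qed.

End AssociatedGraded.

Definition canonically_graded (K : fieldType) (A : comFalgType K)
    (m : {vspace A}) : Prop :=
  exists phi : {lrmorphism A -> gr m}, bijective phi.

Definition gorenstein_Oseq (K : fieldType) (h : seq nat) : Prop :=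
  [/\ all (fun n => 0 < n)%N h, nth 0%N h 0 = 1%N
    & exists (A : comFalgType K) (m : {vspace A}),
        [/\ artinian_local A, is_maximal_ideal m, gorenstein m
          & hilbert_function m h]].

(* Main.v *)
From HB Require Import structures.
Require Import Defs.
From mathcomp Require Import all_boot all_algebra falgebra.
From mathcomp Require Import generic_quotient ring_quotient.
From mathcomp Require Import zify ring.
From mathcomp.multinomials Require Import mpoly.
Set Implicit Arguments.
Unset Strict Implicit.
Unset Printing Implicit Defensive.
Import GRing.Theory.
Local Open Scope ring_scope.

(* An algebra A is canonically graded if and only if there are subspaces B_i
   with B_i B_j contained in B_(i+j) and m^i = B_i + m^(i+1) (direct sum).

   If h1 = h3, duality for a form A -> K that does not vanish on the socle gives
   0 : m^3 = m^2. If moreover h2 is maximal, the square of a complement B of m^2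
   in m is a complement of m^3 in m^2. Every functional on B^2 is then given by
   an element of m^2, so that the generators can be corrected by elements of
   m^2 to make the form vanish on the products of three generators. The powers
   of the span of the corrected generators form a grading.

   Conversely, a grading makes the pairing of degrees 1 and 3 perfect, whence
   h1 = h3. If h1 = h3 = n and n <= h2 < n (n + 1) / 2, there is a quartic form F
   with this Hilbert function that is linear in one of its variables, y. In the
   algebra with inverse system F + y^3 the dual variable Y has its square in m^3;
   in a graded algebra, some element congruent to Y modulo m^2 would then have
   square zero, but here none has. *)

(** * Powers of an ideal *)

Section Powers.
Variables (K : fieldType) (A : comFalgType K).
Implicit Types (a b : A) (m U V W : {vspace A}).

Lemma prodvC U V : (U * V = V * U)%VS.
Proof.
by apply: subv_anti; apply/andP; split; apply/prodvP => u v uU vV;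
  rewrite mulrC memv_mul.
Qed.

Lemma ideal_pow0 m : ideal_pow m 0 = fullv.
Proof. by rewrite /ideal_pow expv0 prodv1. Qed.

Lemma ideal_powSr m i : ideal_pow m i.+1 = (m * ideal_pow m i)%VS.
Proof. by rewrite /ideal_pow expvSl prodvA [(fullv * m)%VS]prodvC prodvA. Qed.

Lemma ideal_pow1 m : is_ideal m -> ideal_pow m 1 = m.
Proof.
move=> mI; apply: subv_anti; rewrite /ideal_pow expv1; apply/andP; split.
  by apply/prodvP => a x _; apply: mI.
by apply/subvP => x xm; rewrite -[x]mul1r memv_mul ?memvf.
Qed.

Lemma mem_ideal_pow1 m a : is_ideal m -> (a \in ideal_pow m 1) = (a \in m).
Proof. by move/ideal_pow1 ->. Qed.

Lemma ideal_pow_mono m i j : (i <= j)%N -> (ideal_pow m j <= ideal_pow m i)%VS.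
Proof.
move=> /subnK <-; elim: (j - i)%N => //= k IH.
by rewrite addSn; apply: subv_trans IH; apply: ideal_powS.
Qed.

Lemma ideal_pow_mul m i a b : b \in ideal_pow m i -> a * b \in ideal_pow m i.
Proof. by move=> bi; apply: (@mem_ideal_powM _ _ _ 0) => //; apply: mem_ideal_pow0. Qed.

Lemma exp_mem_ideal_pow m a k n :
  a \in ideal_pow m k -> a ^+ n \in ideal_pow m (k * n).
Proof.
move=> ak; elim: n => [|n IH]; first by rewrite muln0 mem_ideal_pow0.
by rewrite exprS mulnS mem_ideal_powM.
Qed.

(** [prods] lists the products of unordered pairs of basis vectors, repetitions allowed; by
    commutativity they span U * U. *)
Lemma dim_sqv U : (\dim (U * U) <= 'C((\dim U).+1, 2))%N.
Proof.
pose fix prods (s : seq A) :=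
  if s is x :: s' then [seq x * y | y <- s] ++ prods s' else [::].
have size_prods s : size (prods s) = 'C((size s).+1, 2).
  elim: s => // x s IH.
  rewrite -[prods _]/([seq x * y | y <- x :: s] ++ prods s) size_cat size_map IH.
  by rewrite [RHS]binS bin1 addnC.
have mem_prods s x y : x \in s -> y \in s -> x * y \in prods s.
  elim: s => // z s IH xs ys.
  rewrite -[prods _]/([seq z * y | y <- z :: s] ++ prods s) mem_cat.
  move: (xs) (ys); rewrite !(in_cons z).
  case/predU1P=> [-> _|xs']; first by rewrite map_f.
  case/predU1P=> [->|ys']; first by rewrite mulrC map_f.
  by rewrite IH ?orbT.
rewrite -[X in (_ <= 'C(X.+1, 2))%N](size_tuple (vbasis U)) -size_prods.
apply: leq_trans (dim_span _); apply: dimvS; apply/prodvP => u v uU vU.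
rewrite (coord_vbasis uU) (coord_vbasis vU) mulr_suml memv_suml // => i _.
rewrite mulr_sumr memv_suml // => j _.
rewrite -scalerAl -scalerAr !memvZ // memv_span // mem_prods // mem_nth //;
  by rewrite size_tuple.
Qed.

End Powers.

(** * Gorenstein duality *)

Lemma exists_functional (K : fieldType) (V : vectType K) (v : V) :
  v != 0 -> exists f : 'Hom(V, K^o), f v != 0.
Proof.
move=> v0; have [i vi0] : exists i, coord (vbasis fullv) i v != 0.
  apply/existsP; apply: contraR v0 => /existsPn c0.
  rewrite (coord_vbasis (memvf v)) big1 // => i _.
  by have /negPn/eqP -> := c0 i; rewrite scale0r.
by exists (linfun (coord (vbasis fullv) i : V -> K^o)); rewrite lfunE.
Qed.

Section Duality.
Variables (K : fieldType) (A : comFalgType K).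
Implicit Types (a b x : A) (m J : {vspace A}) (phi : 'Hom(A, K^o)).

(** Such a functional makes a |-> phi (a * _) an isomorphism from A to its dual. *)
Definition nondegenerate phi := forall a, (forall b, phi (a * b) = 0) -> a = 0.

(* If a is nonzero and k is maximal with a m^k != 0, then a m^k is contained
   in the socle, where phi does not vanish. *)
Lemma gorenstein_form m N : is_ideal m -> ideal_pow m N = 0%VS -> gorenstein m ->
  exists2 phi, nondegenerate phi
    & forall a, a \in annihilator m -> phi a = 0 -> a = 0.
Proof.
move=> mI mN gor.
have /eqP := gor; rewrite -[_ == _]/(\dim _ == 1)%N => dim1.
have [z z0 annE] : exists2 z, z != 0 & annihilator m = <[z]>%VS.
  have nz : annihilator m != 0%VS by rewrite -dimv_eq0 (eqP dim1).
  exists (vpick (annihilator m)); first by rewrite vpick0.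
  apply/eqP; rewrite eq_sym eqEdim -memvE memv_pick (eqP dim1) dim_vline.
  by rewrite vpick0 nz.
have [phi phiz] := exists_functional z0.
have phi_ann a : a \in annihilator m -> phi a = 0 -> a = 0.
  rewrite annE => /vlineP[k ->]; rewrite linearZ => /eqP.
  by rewrite scaler_eq0 (negPf phiz) orbF => /eqP ->; rewrite scale0r.
exists phi => // a phi_a.
have red k : (forall b, b \in ideal_pow m k -> a * b = 0) -> a = 0.
  elim: k => [|k IH] ak; first by rewrite -[a]mulr1 ak ?mem_ideal_pow0.
  apply: IH => b bk; apply: phi_ann; last exact: phi_a.
  apply/annihilatorP => x xm; rewrite -mulrA ak // mulrC ideal_powSr.
  by rewrite memv_mul.
by apply: (red N) => b; rewrite mN memv0 => /eqP ->; rewrite mulr0.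
Qed.

Section Form.
Variables (phi : 'Hom(A, K^o)) (nd : nondegenerate phi).

Let gram J a : 'rV[K]_(\dim J) := \row_i phi (a * (vbasis J)`_i).

Let gram_linear J : linear (@gram J).
Proof.
by move=> k a b; apply/rowP => i; rewrite !mxE mulrDl -scalerAl linearP.
Qed.
HB.instance Definition _ J := GRing.isLinear.Build K A _ _ (@gram J) (@gram_linear J).

Let gramP J a : (forall b, b \in J -> phi (a * b) = 0) <-> gram J a = 0.
Proof.
split=> [aJ|ga b bJ].
  apply/rowP => i; rewrite !mxE aJ // vbasis_mem // mem_nth //.
  by rewrite size_tuple.
rewrite (coord_vbasis bJ) mulr_sumr linear_sum big1 // => i _.
move/rowP/(_ i): ga; rewrite !mxE -scalerAr linearZ /= => ->.
by rewrite scaler0.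
Qed.

Let Gram := linfun (gram fullv).

Let Gram_inj : lker Gram == 0%VS.
Proof.
apply/eqP/vspaceP => a; rewrite memv0 memv_ker lfunE /=; apply/eqP/eqP.
  by move=> /gramP ga; apply: nd => b; apply: ga; apply: memvf.
by move=> ->; rewrite linear0.
Qed.

Let GramVE r a :
  phi (Gram^-1%VF r * a) = \sum_i coord (vbasis fullv) i a * r 0 i.
Proof.
rewrite {1}(coord_vbasis (memvf a)) mulr_sumr linear_sum.
apply: eq_bigr => i _; rewrite -scalerAr linearZ; congr (_ * _).
have Gram_full : limg Gram = fullv.
  apply/eqP; rewrite eqEdim subvf limg_dim_eq ?capfv ?(eqP Gram_inj) //.
  by rewrite [X in (X <= _)%N]dimvf dim_matrix mul1r leqnn.
have : Gram (Gram^-1%VF r) = r by rewrite limg_lfunVK // Gram_full memvf.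
by rewrite lfunE => /rowP/(_ i); rewrite mxE.
Qed.

Lemma form_represents (f : 'Hom(A, K^o)) :
  exists u, forall a, phi (u * a) = f a.
Proof.
exists (Gram^-1%VF (\row_i f (vbasis fullv)`_i)) => a.
rewrite GramVE [in RHS](coord_vbasis (memvf a)) linear_sum.
by apply: eq_bigr => i _; rewrite mxE linearZ.
Qed.

(** The adjoint of E for the pairing phi (x * a), built as a linear map so that it can later correct
    all generators at once. *)
Lemma form_transpose (E : 'End(A)) :
  exists U : 'End(A), forall x a, phi (U x * a) = phi (x * E a).
Proof.
pose r x : 'rV[K]_(\dim {:A}) := \row_i phi (x * E (vbasis fullv)`_i).
have r_lin : linear r.
  by move=> k a b; apply/rowP => i; rewrite !mxE mulrDl -scalerAl linearP.
pose rL := GRing.isLinear.Build K A _ _ r r_lin.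
pose rl : {linear A -> _} := HB.pack r rL.
exists (Gram^-1 \o linfun rl)%VF => x a.
rewrite comp_lfunE GramVE lfunE /= [in RHS](coord_vbasis (memvf a)).
rewrite linear_sum mulr_sumr linear_sum; apply: eq_bigr => i _.
by rewrite mxE linearZ -scalerAr linearZ.
Qed.

(** As J is an ideal, its annihilator is its orthogonal for the pairing phi (a * b). Every
    functional on J extends to A through the projection onto J and is represented there, so the
    orthogonal has complementary dimension. *)
Lemma dim_annihilator J : is_ideal J ->
  (\dim (annihilator J) + \dim J = \dim {:A})%N.
Proof.
move=> JI; pose T := linfun (gram J).
have kerT : lker T = annihilator J.
  apply/vspaceP => a; rewrite memv_ker lfunE /=; apply/eqP/annihilatorP => [|aJ].
    move=> /gramP ga b bJ; apply: nd => c; rewrite -mulrA ga //.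
    by rewrite mulrC JI.
  by apply/gramP => b bJ; rewrite aJ ?linear0.
have imT : limg T = fullv.
  apply/vspaceP => r; rewrite memvf; apply/memv_imgP.
  pose f a : K^o := \sum_j r 0 j * coord (vbasis J) j (projv J a).
  have f_lin : linear f.
    move=> k a b; rewrite /f scaler_sumr -big_split; apply: eq_bigr => j _ /=.
    by rewrite !linearP /= mulrDr mulrCA.
  pose fL := GRing.isLinear.Build K A _ _ f f_lin.
  pose fl : {linear A -> K^o} := HB.pack f fL.
  have [u uf] := form_represents (linfun fl).
  exists u; first exact: memvf.
  apply/rowP => j; rewrite lfunE /= mxE uf lfunE /= /f.
  rewrite projv_id ?vbasis_mem ?mem_nth ?size_tuple //.
  rewrite (bigD1 j) //= big1 => [|i ij].
    by rewrite coord_free ?(basis_free (vbasisP J)) // eqxx mulr1 addr0.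
  by rewrite coord_free ?(basis_free (vbasisP J)) // eq_sym (negPf ij) mulr0.
have := limg_ker_dim T fullv; rewrite capfv kerT imT dimvf dim_matrix mul1r.
by move=> ->; rewrite dimvf.
Qed.

End Form.
End Duality.

(** * Gradings *)

Section Grading.
Variables (K : fieldType) (A : comFalgType K) (m : {vspace A}).
Implicit Types (a b : A) (B : nat -> {vspace A}).

Local Notation P := (ideal_pow m).
Local Notation pi := (\pi_(gr m))%qT.

Lemma gr_pi0 : pi 0 = 0. Proof. exact: raddf0. Qed.

Lemma monomial_mem i a : a \in P i -> a *: 'X^i \in rees_pred m.
Proof.
move=> ai; apply/rees_predP => j; rewrite coefZ coefXn.
by case: eqP => [->|_]; rewrite ?mulr1 ?mulr0 ?mem0v.
Qed.

Definition grading B :=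
  [/\ 1 \in B 0%N,
      forall i j a b, a \in B i -> b \in B j -> a * b \in B (i + j)%N,
      forall k, (B k + P k.+1 = P k)%VS
    & forall k, (B k :&: P k.+1 = 0)%VS].

(** * From a grading to an isomorphism with gr m *)

Section FromGrading.
Variables (N : nat) (PN : P N = 0%VS) (B : nat -> {vspace A}).
Hypothesis gB : grading B.

(** The projection onto B_i along m^(i+1) picks the representative in B_i of a class of m^i /
    m^(i+1). *)
Let rho i := daddv_pi (B i) (P i.+1).

Let rhoB i a : rho i a \in B i. Proof. exact: memv_pi. Qed.

Let BP i : (B i <= P i)%VS.
Proof. by case: gB => _ _ /(_ i) <- _; apply: addvSl. Qed.

Let rho_sub i a : a \in P i -> a - rho i a \in P i.+1.
Proof.
case: gB => _ _ BD B0 ai; rewrite -{1}(daddv_pi_add (B0 i) (w := a)) ?BD //.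
by rewrite addrC addKr memv_pi.
Qed.

Let rho_uniq i a b : a \in P i -> b \in B i -> a - b \in P i.+1 -> rho i a = b.
Proof.
case: gB => _ _ _ /(_ i) B0 ai bi abi; apply/eqP; rewrite -subr_eq0 -memv0 -B0.
rewrite memv_cap memvB ?rhoB //=.
have -> : rho i a - b = (a - b) - (a - rho i a).
  by rewrite opprB [RHS]addrC addrA subrK.
by rewrite memvB // rho_sub.
Qed.

(** Adds up the homogeneous representatives of the classes. The choice made by [repr] is harmless by
    [psiE], and the sum stops at N because m^N = 0. *)
Let psi (x : gr m) : A := \sum_(i < N) rho i (rees_val (repr x))`_i.

Let psiE (p : rees m) : psi (pi p) = \sum_(i < N) rho i (rees_val p)`_i.
Proof.
rewrite /psi; apply: eq_bigr => i _; apply/eqP; rewrite eq_sym -subr_eq0 -linearB /=.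
have /rees_idealP/(_ i) := repr_gr p; rewrite rees_valB coefB => di.
apply/eqP/rho_uniq; rewrite ?mem0v ?subr0 //.
by rewrite memvB ?rees_coef.
Qed.

Let psi_linear (k : K) (x y : gr m) : psi (k *: x + y) = k *: psi x + psi y.
Proof.
elim/quotW: x => p; elim/quotW: y => q.
rewrite -[k *: _]/(gr_scale _ _) gr_scaleE -gr_addE !psiE scaler_sumr -big_split.
apply: eq_bigr => i _ /=; rewrite coefD -linearP; congr (rho i (_ + _)).
by rewrite coefZ -scalerAl mul1r.
Qed.

Let P_ge i a : (N <= i)%N -> a \in P i -> a = 0.
Proof. by move=> Ni /(subvP (ideal_pow_mono m Ni)); rewrite PN memv0 => /eqP. Qed.

(* psi p is the value at t = 1 of the polynomial of the homogeneous components
   of p, which is multiplicative in p. *)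
Let comp (p : rees m) := \poly_(i < N) rho i (rees_val p)`_i.

Let psi_comp p : psi (pi p) = (comp p).[1].
Proof.
rewrite psiE horner_poly; apply: eq_bigr => i _.
by rewrite expr1n mulr1.
Qed.

Let comp_coef p i : (comp p)`_i = rho i (rees_val p)`_i.
Proof.
rewrite coef_poly; case: ltnP => // Ni.
by rewrite (P_ge Ni (rees_coef p i)) linear0.
Qed.

(** In degree k, the sum of products of representatives lies in B_k and is congruent to the
    coefficient of the product modulo m^(k+1), so [rho_uniq] applies. *)
Let compM p q : comp (p * q) = comp p * comp q.
Proof.
apply/polyP => k; rewrite comp_coef rees_valM !coefM.
have jk (j : 'I_k.+1) : (j + (k - j) = k)%N by rewrite subnKC // -ltnS.
apply: rho_uniq.
- rewrite memv_suml // => j _.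
  by have := mem_ideal_powM (rees_coef p j) (rees_coef q (k - j)); rewrite jk.
- rewrite memv_suml // => j _; rewrite !comp_coef; case: gB => _ BM _ _.
  by have := BM _ _ _ _ (rhoB j (rees_val p)`_j)
    (rhoB (k - j)%N (rees_val q)`_(k - j)%N); rewrite jk.
rewrite -sumrB memv_suml // => j _; rewrite !comp_coef.
set a := (rees_val p)`_j; set b := (rees_val q)`_(k - j)%N.
have -> : a * b - rho j a * rho (k - j)%N b
        = (a - rho j a) * b + rho j a * (b - rho (k - j)%N b).
  by rewrite mulrBl mulrBr addrA subrK.
have ab := mem_ideal_powM (rho_sub (rees_coef p j)) (rees_coef q (k - j)).
have ra : rho j a \in P j by rewrite (subvP (BP j)) ?rhoB.
have rb := mem_ideal_powM ra (rho_sub (rees_coef q (k - j))).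
by move: ab rb; rewrite addSn addnS jk; apply: memvD.
Qed.

Let psi_mul (x y : gr m) : psi (x * y) = psi x * psi y.
Proof.
elim/quotW: x => p; elim/quotW: y => q.
by rewrite -[_ * _]/(gr_mul _ _) gr_mulE !psi_comp compM hornerM.
Qed.

Let psi1 : psi 1 = 1.
Proof.
rewrite -[1]/(gr_one m) /gr_one psi_comp.
suff -> : comp 1 = 1 by rewrite hornerC.
apply/polyP => i; rewrite comp_coef; case: gB => B1 _ _ _.
apply: rho_uniq; rewrite ?rees_coef //.
  by rewrite coef1; case: i => [|i]; rewrite ?mem0v.
by rewrite subrr mem0v.
Qed.

Let psi_inj : injective psi.
Proof.
move=> x y xy; apply/eqP; rewrite -subr_eq0; apply/eqP.
have: psi (x - y) = 0.
  by rewrite addrC -scaleN1r psi_linear xy scaleN1r addNr.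
move: (x - y); elim/quotW => p /eqP; rewrite psiE => /eqP p0.
(* When the components below k vanish, the zero sum expresses the k-th one through components of
   higher degree, so it lies in B_k and in m^(k+1). *)
have rho0 k : rho k (rees_val p)`_k = 0.
  elim/ltn_ind: k => k IH; have [kN|Nk] := ltnP k N; last first.
    by rewrite (P_ge Nk (rees_coef p k)) linear0.
  case: gB => _ _ _ /(_ k) B0; apply/eqP; rewrite -memv0 -B0 memv_cap rhoB /=.
  move: p0; rewrite (bigD1 (Ordinal kN)) //= => /eqP.
  rewrite addr_eq0 => /eqP ->; rewrite memvN memv_suml // => i.
  rewrite -val_eqE /= => ik; case: (ltngtP i k) ik => // [ik|ki] _.
    by rewrite IH ?mem0v.
  by rewrite (subvP (ideal_pow_mono m ki)) // (subvP (BP i)) ?rhoB.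
rewrite -gr_pi0; apply/gr_eqP; rewrite subr0; apply/rees_idealP => i.
by have := rho_sub (rees_coef p i); rewrite rho0 subr0.
Qed.

(** Descending induction on the power of m that contains a: subtracting [rho i a] moves a from m^i
    to m^(i+1). *)
Let psi_onto a : exists x, psi x = a.
Proof.
suff: forall k, a \in P (N - k) -> exists x, psi x = a.
  by move/(_ N); rewrite subnn mem_ideal_pow0; apply.
move=> k; elim: k a => [|k IH] a.
  rewrite subn0 PN memv0 => /eqP ->; exists 0.
  by rewrite -gr_pi0 psiE big1 // => i _; rewrite coef0 linear0.
have [kN|Nk] := ltnP k N; last first.
  have -> : (N - k.+1 = N - k)%N by lia.
  exact: IH.
set i := (N - k.+1)%N => ai; have iS : (N - k)%N = i.+1 by rewrite /i subnSK.
have iN : (i < N)%N by rewrite /i; lia.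
have [x xa] : exists x, psi x = a - rho i a by apply: IH; rewrite iS rho_sub.
exists (1 *: pi (Rees (monomial_mem ai)) + x); rewrite psi_linear scale1r xa.
rewrite psiE (bigD1 (Ordinal iN)) //= coefZ coefXn eqxx mulr1 big1 => [|j].
  by rewrite addr0 addrC subrK.
by rewrite -val_eqE coefZ coefXn /= => /negPf ->; rewrite mulr0 linear0.
Qed.

Lemma grading_canonically_graded : canonically_graded m.
Proof.
have [phi phiK psiK] : bijective psi.
  have onto a : exists x, psi x == a by have [x <-] := psi_onto a; exists x.
  exists (fun a => xchoose (onto a)) => [x|a]; last exact/eqP/(xchooseP (onto a)).
  by apply: psi_inj; apply/eqP/(xchooseP (onto (psi x))).
have phiL : linear phi.
  by move=> k a b; apply: psi_inj; rewrite psi_linear !psiK.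
have phiM : monoid_morphism phi.
  split=> [|a b]; apply: psi_inj; rewrite ?psi_mul !psiK // psi1 //.
pose L := GRing.isLinear.Build K A _ _ phi phiL.
pose M := GRing.isMonoidMorphism.Build _ _ phi phiM.
pose f : {lrmorphism A -> gr m} := HB.pack phi L M.
by exists f, psi.
Qed.

End FromGrading.
End Grading.

(** * From an isomorphism with gr m to a grading *)

Section ToGrading.
Variables (K : fieldType) (A : comFalgType K) (m : {vspace A}).
Hypotheses (mI : is_ideal m) (m1 : 1 \notin m).
Hypothesis (mK : forall a : A, exists k : K, a - k%:A \in m).
Variables (N : nat) (PN : ideal_pow m N = 0%VS).
Implicit Types (a b : A) (p r : rees m).

Local Notation P := (ideal_pow m).
Local Notation pi := (\pi_(gr m))%qT.

(** An element congruent to a nonzero scalar k modulo m has its n-th power congruent to the unit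
    k^n, hence outside m. *)
Lemma exp_mem_maximal a n : a ^+ n \in m -> a \in m.
Proof.
have [k ak] := mK a; move=> an.
suff k0 : k = 0 by move: ak; rewrite k0 scale0r subr0.
apply: contraNeq m1 => k0.
have: (k ^+ n)^-1 *: k%:A ^+ n \in m.
  have -> : k%:A ^+ n = a ^+ n - (a ^+ n - k%:A ^+ n) :> A by rewrite subKr.
  by rewrite memvZ // memvB // subrXX mulrC mI.
by rewrite exprZn expr1n scalerA mulVf ?expf_neq0 // scale1r.
Qed.

(* q will be the projection of the Rees algebra onto gr m, followed by the
   inverse of an isomorphism from A to gr m. *)
Variable q : rees m -> A.
Hypotheses (qD : forall p r, q (p + r) = q p + q r)
  (qZ : forall (k : K) p, q (k%:A *: p) = k *: q p)
  (qM : forall p r, q (p * r) = q p * q r) (q1 : q 1 = 1)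
  (q_onto : forall a, exists p, q p = a)
  (q_eq : forall p r, q p = q r <-> p - r \in @rees_ideal _ _ m).

Let mono i a : rees m := Rees (monomial_mem (memv_proj (P i) a)).

Let h i a := q (mono i a).

Let h_linear i : linear (h i).
Proof.
move=> k a b; rewrite /h -qZ -qD; congr q; apply: val_inj => /=.
by rewrite linearP scalerDl /= scalerA mulr_algl.
Qed.
HB.instance Definition _ i := GRing.isLinear.Build K A A _ (h i) (h_linear i).

Let hM i j a b : a \in P i -> b \in P j -> h (i + j) (a * b) = h i a * h j b.
Proof.
move=> ai bj; rewrite /h -qM; congr q; apply: val_inj => /=.
rewrite !projv_id ?mem_ideal_powM //.
by rewrite -scalerAl -scalerAr scalerA exprD.
Qed.

Let h_proj i a : h i (projv (P i) a) = h i a.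
Proof. by congr q; apply: val_inj; rewrite /= projv_proj. Qed.

Let q0 : q 0 = 0.
Proof. by apply: (addrI (q 0)); rewrite -qD !addr0. Qed.

(** That the isomorphism respects m has to be proved. The element a t of the Rees algebra is
    nilpotent as a^N = 0, and nilpotent elements of A lie in m. *)
Let h_nil a : a \in m -> h 1 a \in m.
Proof.
move=> am; apply: (@exp_mem_maximal _ N).
have powE n : h 1 a ^+ n = q (mono 1 a ^+ n).
  by elim: n => [|n IH]; rewrite ?q1 // !exprS qM IH.
suff -> : h 1 a ^+ N = q 0 by rewrite q0 mem0v.
rewrite powE; congr q; apply: val_inj.
have am1 : a \in P 1 by rewrite mem_ideal_pow1.
have powV n : rees_val (mono 1 a ^+ n) = a ^+ n *: 'X^n.
  elim: n => [|n IH]; first by rewrite !expr0 scale1r.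
  rewrite exprS rees_valM IH /= projv_id // -scalerAl -scalerAr scalerA.
  by rewrite -exprS -exprD.
rewrite -[LHS]/(rees_val _) powV; have := exp_mem_ideal_pow N am1.
by rewrite mul1n PN memv0 => /eqP ->; rewrite scale0r.
Qed.

Let h_mem k a : a \in P k -> h k a \in P k.
Proof.
elim: k a => [|[|k] IH] a; first by rewrite !mem_ideal_pow0.
  by rewrite !mem_ideal_pow1 //; apply: h_nil.
rewrite ideal_powSr => akS.
have /subvP/(_ a akS) : (m * P k.+1 <= linfun (h k.+2) @^-1: P k.+2)%VS.
  apply/prodvP => u v um vk; rewrite -memv_preim lfunE /=.
  have um1 : u \in P 1 by rewrite mem_ideal_pow1.
  rewrite (hM um1 vk); apply: (@mem_ideal_powM _ _ _ 1); last exact: IH.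
  by rewrite mem_ideal_pow1 // h_nil.
by rewrite -memv_preim lfunE /= ideal_powSr.
Qed.

Let q_ontob a : exists p, q p == a.
Proof. by have [p <-] := q_onto a; exists p. Qed.

(** The component of degree i of a in the grading carried over from gr m. The lift of a is arbitrary
    because h_i vanishes on m^(i+1), see [gE]. *)
Let g i a := h i (rees_val (xchoose (q_ontob a)))`_i.

Let h_succ i a : a \in P i.+1 -> h i a = 0.
Proof.
move=> ai; rewrite -q0; apply/q_eq/rees_idealP => j.
rewrite subr0 /= coefZ coefXn projv_id ?(subvP (ideal_powS m i)) //.
by case: eqP => [->|_]; rewrite ?mulr1 // mulr0 mem0v.
Qed.

Let gE i p : g i (q p) = h i (rees_val p)`_i.
Proof.
rewrite /g; set p' := xchoose _; apply/eqP; rewrite -subr_eq0 -linearB /=.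
have /eqP/q_eq/rees_idealP/(_ i) := xchooseP (q_ontob (q p)).
move=> dp; apply/eqP/h_succ; move: dp; rewrite -/p'.
by rewrite rees_valB coefB.
Qed.

Let g_linear i : linear (g i).
Proof.
move=> k a b; have [p <-] := q_onto a; have [r <-] := q_onto b.
rewrite -qZ -qD !gE -linearP; congr (h i _).
by rewrite -[rees_val _]/(k%:A *: rees_val p + rees_val r) coefD coefZ mulr_algl.
Qed.
HB.instance Definition _ i := GRing.isLinear.Build K A A _ (g i) (g_linear i).

Let gM k a b : g k (a * b) = \sum_(i < k.+1) g i a * g (k - i) b.
Proof.
have [p <-] := q_onto a; have [r <-] := q_onto b.
rewrite -qM gE rees_valM coefM linear_sum; apply: eq_bigr => i _ /=.
rewrite !gE -hM ?rees_coef // subnKC // -ltnS //.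
Qed.

(** An element of m is nilpotent, so its component of degree 0 vanishes; the formula [gM] for the
    components of a product extends this to m^k by induction. *)
Let g_small k i a : a \in P k -> (i < k)%N -> g i a = 0.
Proof.
have g0 u : u \in m -> g 0 u = 0.
  have [p <-] := q_onto u; rewrite -mem_ideal_pow1 // => /(exp_mem_ideal_pow N).
  rewrite mul1n PN memv0 => qpN; rewrite gE h_succ // mem_ideal_pow1 //.
  apply: (@exp_mem_maximal _ N); rewrite -mem_ideal_pow1 //.
  have powE n : q p ^+ n = q (p ^+ n).
    by elim: n => [|n IH]; rewrite ?q1 // !exprS qM IH.
  have powV n : (rees_val (p ^+ n))`_0 = (rees_val p)`_0 ^+ n.
    elim: n => [|n IH]; first by rewrite !expr0 coefC.
    by rewrite !exprS rees_valM coef0M IH.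
  have /q_eq/rees_idealP/(_ 0%N) : q (p ^+ N) = q 0.
    by rewrite q0 -powE; apply/eqP.
  by rewrite subr0 powV.
elim: k i a => // k IH i a ak ik.
have {}ik : (i <= k)%N by [].
suff /subvP/(_ _ ak) : (P k.+1 <= lker (linfun (g i)))%VS.
  by rewrite memv_ker lfunE => /eqP.
rewrite ideal_powSr; apply/prodvP => u v um vk; rewrite memv_ker lfunE /= gM.
rewrite big_ord_recl /= big1 ?addr0 => [|j _].
  by rewrite subn0 g0 ?mul0r.
by rewrite (IH (i - bump 0 j)%N) ?mulr0 // /bump; have := ltn_ord j; lia.
Qed.

(** The bound n is taken above k so that the sum has a term of index k in [exists_grading]. *)
Let g_sum k a : exists2 n, (k < n)%N & a = \sum_(i < n) g i a.
Proof.
have [p <-] := q_onto a; exists (maxn (size (rees_val p)) k.+1).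
  by rewrite leq_maxr.
set n := maxn _ _; have q_sum (F : 'I_n -> rees m) :
    \sum_i q (F i) = q (\sum_i F i).
  by elim/big_rec2: _ => [|i x y _ ->]; rewrite ?q0 ?qD.
have val_sum : rees_val (\sum_(i < n) mono i (rees_val p)`_i)
        = \sum_(i < n) (rees_val p)`_i *: 'X^i.
  elim/big_rec2: _ => // i x y _ xy.
  by rewrite -[LHS]/(projv (P i) (rees_val p)`_i *: 'X^i + rees_val y)
    projv_id ?rees_coef // xy.
under eq_bigr do rewrite gE; rewrite q_sum; congr q; apply: val_inj.
apply: etrans (esym val_sum); apply/polyP => j.
rewrite -poly_def coef_poly; case: ltnP => // nj.
by rewrite nth_default // (leq_trans _ nj) // leq_maxl.
Qed.

(** B_i is the image in A of the degree i part of gr m. For an element of m^k, the components below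
    k vanish and those above k lie in m^(k+1). An element of B_k is its own component of degree k,
    which vanishes if the element is in m^(k+1). *)
Lemma exists_grading : exists B, grading m B.
Proof.
exists (fun i => limg (linfun (h i))); split.
- apply/memv_imgP; exists 1; rewrite ?memvf // lfunE /= /h -[LHS]q1; congr q.
  apply: val_inj; rewrite /= projv_id ?mem_ideal_pow0 //.
  by rewrite expr0 scale1r.
- move=> i j a b /memv_imgP[a' _ ->] /memv_imgP[b' _ ->]; rewrite !lfunE /=.
  rewrite -(h_proj i) -(h_proj j) -hM ?memv_proj //.
  by apply/memv_imgP; exists (projv (P i) a' * projv (P j) b');
    rewrite ?memvf ?lfunE.
- move=> k; apply: subv_anti; rewrite subv_add ideal_powS andbT; apply/andP; split.
    apply/subvP => _ /memv_imgP[a _ ->]; rewrite lfunE /= -h_proj.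
    by rewrite h_mem ?memv_proj.
  apply/subvP => a ak; have [n kn aE] := g_sum k a.
  rewrite aE (bigD1 (Ordinal kn)) //= memv_add //.
    have [p <-] := q_onto a; rewrite gE.
    by apply/memv_imgP; exists (rees_val p)`_k; rewrite ?memvf ?lfunE.
  rewrite memv_suml // => i; rewrite -val_eqE /= => ik.
  case: (ltngtP i k) ik => // [ik|ki] _; first by rewrite (g_small ak ik) mem0v.
  have [p <-] := q_onto a; rewrite gE.
  by rewrite (subvP (ideal_pow_mono m ki)) // h_mem // rees_coef.
move=> k; apply/eqP; rewrite -subv0; apply/subvP => b; rewrite memv_cap => /andP[].
move=> /memv_imgP[a _ ->]; rewrite lfunE /= => /g_small/(_ (ltnSn k)).
by rewrite {1}/h gE /= coefZ coefXn eqxx mulr1 h_proj => ->; rewrite mem0v.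
Qed.

End ToGrading.

(** * Gorenstein algebras of socle degree 4 *)

Section SocleDegreeFour.
Variables (K : fieldType) (A : comFalgType K) (m : {vspace A}).
Local Notation P := (ideal_pow m).

Lemma canonically_graded_grading N : is_ideal m -> 1 \notin m ->
  (forall a : A, exists k : K, a - k%:A \in m) -> P N = 0%VS ->
  canonically_graded m -> exists B, grading m B.
Proof.
move=> mI m1 mK PN [phi [psi phiK psiK]].
apply: (@exists_grading _ _ _ mI m1 mK _ PN (fun p => psi (\pi_(gr m)%qT p))).
- move=> p r; apply: (can_inj phiK).
  by rewrite psiK gr_addE [RHS]raddfD /= !psiK.
- move=> k p; apply: (can_inj phiK).
  by rewrite psiK -gr_scaleE [RHS]linearZ /= psiK.
- move=> p r; apply: (can_inj phiK).
  by rewrite psiK -gr_mulE [RHS]rmorphM /= !psiK.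
- by apply: (can_inj phiK); rewrite rmorph1 psiK.
- by move=> a; exists (repr (phi a)); rewrite reprK phiK.
by move=> p r; split=> [/(can_inj psiK) pr|/gr_eqP -> //]; apply/gr_eqP.
Qed.

Variables h1 h2 h3 : nat.
Hypotheses (mM : is_maximal_ideal m) (gor : gorenstein m).
Hypothesis hf : hilbert_function m [:: 1; h1; h2; h3; 1]%N.

Let mI : is_ideal m. Proof. by case: mM. Qed.

Lemma hilb4_dims : [/\ P 5 = 0%VS, \dim (P 4) = 1%N, \dim (P 3) = h3.+1,
   \dim (P 2) = (h2 + h3.+1)%N
   & \dim m = (h1 + (h2 + h3.+1))%N /\ \dim {:A} = (\dim m).+1].
Proof.
case: hf => s [Ps smax] hE.
have s4 : s = 4%N by move/(congr1 size): hE; rewrite size_mkseq => -[].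
subst s; move: hE; rewrite /mkseq /= /hilb => -[e0 e1 e2 e3 e4].
have P5 : P 5 = 0%VS by apply/eqP; apply/negPn/negP => /eqP /smax.
have le k := dimvS (ideal_powS m k).
have dm : \dim m = \dim (P 1) by rewrite ideal_pow1.
have dA : \dim {:A} = \dim (P 0) by rewrite ideal_pow0.
move: e0 e1 e2 e3 e4 (le 0%N) (le 1%N) (le 2%N) (le 3%N).
by rewrite P5 dimv0 => *; split=> //; last split; lia.
Qed.

Lemma one_notin : 1 \notin m.
Proof.
case: mM => _ mT _; apply/negP => m1; apply: mT; apply/vspaceP => a.
by rewrite memvf -[a]mulr1 mI.
Qed.

(** Since h_0 = 1, the ideal m has codimension 1, and it does not contain 1. *)
Lemma residue (a : A) : exists k : K, a - k%:A \in m.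
Proof.
have [_ _ _ _ [_ dA]] := hilb4_dims.
have : a \in (<[1]> + m)%VS.
  suff -> : (<[1]> + m)%VS = fullv by apply: memvf.
  have cap0 : (<[1%R : A]> :&: m = 0)%VS.
    apply/eqP; rewrite -subv0; apply/subvP => b; rewrite memv_cap memv0.
    case/andP => /vlineP[k ->] km.
    have [->|k0] := eqVneq k 0; first by rewrite scale0r.
    have : k^-1 *: k%:A \in m by rewrite memvZ.
    by rewrite scalerA mulVf // scale1r (negPf one_notin).
  apply/eqP; rewrite eqEdim subvf dA dimv_disjoint_sum // dim_vline.
  by rewrite oner_neq0 leqnn.
case/memv_addP => _ /vlineP[k ->] [b bm ->]; exists k.
by rewrite addrC addKr.
Qed.

Lemma socle_pow4 : annihilator m = P 4.
Proof.
have [P5 d4 _ _ _] := hilb4_dims.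
apply/eqP; rewrite eq_sym eqEdim d4 gor andbT; apply/subvP => a a4.
apply/annihilatorP => x xm; apply/eqP; rewrite -memv0 -P5 ideal_powSr mulrC.
by rewrite memv_mul.
Qed.

Lemma ideal_pow_ideal i : is_ideal (P i).
Proof. by move=> a x; apply: ideal_pow_mul. Qed.

Lemma pow_mul0 i j (a b : A) : (5 <= i + j)%N -> a \in P i -> b \in P j -> a * b = 0.
Proof.
have [P5 _ _ _ _] := hilb4_dims.
move=> ij ai bj; apply/eqP; rewrite -memv0 -P5.
by rewrite (subvP (ideal_pow_mono m ij)) ?mem_ideal_powM.
Qed.

Lemma pow2_ann : (P 2 <= annihilator (P 3))%VS.
Proof. by apply/subvP => a a2; apply/annihilatorP => x x3; apply: (@pow_mul0 2 3). Qed.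

(** Against dim m^2 = h2 + h3 + 1, this shows that the inclusion [pow2_ann] is an equality exactly
    when h1 = h3. *)
Lemma dim_ann_pow3 : \dim (annihilator (P 3)) = (h1 + h2 + 1)%N.
Proof.
have [P5 d4 d3 d2 [d1 dA]] := hilb4_dims.
have [phi nd _] := gorenstein_form mI P5 gor.
have := dim_annihilator nd (@ideal_pow_ideal 3); lia.
Qed.

(** Modulo m^(k+1), a product of k elements of m depends only on its factors modulo m^2. *)
Lemma generators B k : (B + P 2 = m)%VS -> (B ^+ k + P k.+1 = P k)%VS.
Proof.
move=> BP; have Bm : (B <= m)%VS by rewrite -BP addvSl.
have BkP j : (B ^+ j <= P j)%VS.
  apply: subv_trans (expvS j Bm) _; apply/subvP => a aj.
  by rewrite -[a]mul1r memv_mul ?memvf.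
apply: subv_anti; rewrite subv_add BkP ideal_powS /=.
elim: k => [|k IH].
  rewrite ideal_pow0 ideal_pow1 //; apply/subvP => a _.
  have [c ac] := residue a; rewrite -(subrK c%:A a) addrC memv_add //.
  by rewrite memvZ // memv_line.
rewrite [P k.+1]ideal_powSr; apply/prodvP => x y xm yk.
move: xm; rewrite -{1}BP => /memv_addP[b bB [c c2 ->]].
have /memv_addP[d dB [e eP yde]] := subvP IH _ yk.
have -> : (b + c) * y = b * d + (b * e + c * y).
  by rewrite mulrDl {1}yde mulrDr addrA.
rewrite memv_add //; first by rewrite expvSl memv_mul.
rewrite memvD //; last exact: (@mem_ideal_powM _ _ _ 2).
by rewrite [P k.+2]ideal_powSr memv_mul // (subvP Bm).
Qed.

Lemma h2_le_dim_sqv B : (B + P 2 = m)%VS -> (h2 <= \dim (B * B))%N.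
Proof.
move=> /(@generators B 2) BP; have [_ _ d3 d2 _] := hilb4_dims.
by have [+ _] := dimv_add_leqif (B ^+ 2)%VS (P 3); rewrite BP d2 d3 expv2 leq_add2r.
Qed.

Lemma complement_sq : exists B,
  [/\ (B + P 2 = m)%VS, (B :&: P 2 = 0)%VS & \dim B = h1].
Proof.
have [_ _ _ d2 [d1 _]] := hilb4_dims.
have P2m : (P 2 <= m)%VS by rewrite -[X in (_ <= X)%VS](ideal_pow1 mI) ideal_powS.
exists (m :\: P 2)%VS; split; rewrite ?capv_diff ?addv_diff ?(addv_idPl P2m) //.
by have := dimv_cap_compl m (P 2); rewrite (capv_idPr P2m); lia.
Qed.

Lemma h2_le : (h2 <= 'C(h1.+1, 2))%N.
Proof.
have [B [/h2_le_dim_sqv hB _ dB]] := complement_sq.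
by rewrite (leq_trans hB) // -dB dim_sqv.
Qed.

(* In a graded algebra the pairing of degrees 1 and 3 is perfect, so that
   0 : m^3 = m^2. *)
Lemma grading_symmetric B : grading m B -> h1 = h3.
Proof.
case=> _ BM BP B0; have [P5 d4 d3 d2 [d1 dA]] := hilb4_dims.
suff ann_sub : (annihilator (P 3) <= P 2)%VS.
  have := dimvS ann_sub; have := dimvS pow2_ann; rewrite dim_ann_pow3 d2; lia.
apply/subvP => a /annihilatorP a3.
(* As m kills m^4, a acts on m^4 as its constant term, which must therefore vanish. *)
have am : a \in P 1.
  rewrite ideal_pow1 //; have [k ak] := residue a.
  have [b b4 bn0] : exists2 b, b \in P 4 & b != 0.
    exists (vpick (P 4)); rewrite ?memv_pick // vpick0 -dimv_eq0 d4 //.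
  have : a * b = 0 by rewrite a3 // (subvP (ideal_powS m 3)).
  rewrite -(subrK k%:A a) mulrDl (@pow_mul0 1 4) ?ideal_pow1 // add0r.
  rewrite mulr_algl => /eqP; rewrite scaler_eq0 (negPf bn0) orbF => /eqP k0.
  by move: ak; rewrite k0 scale0r subr0 addr0.
move: am; rewrite -BP => /memv_addP[c c1 [d dP2 acd]].
have c3 x : x \in P 3 -> c * x = 0.
  move=> x3; have := a3 x x3; rewrite acd mulrDl.
  by rewrite (@pow_mul0 2 3 d) // addr0.
(* If c kills m^(j+1) and y is in B_j, then c y lies in B_(j+1) and in the socle m^4, which is
   contained in m^(j+2); so c y = 0. *)
have low j : (j < 3)%N -> (forall x, x \in P j.+1 -> c * x = 0) ->
    forall x, x \in P j -> c * x = 0.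
  move=> j3 cj x; rewrite -BP => /memv_addP[y yj [z zj ->]].
  rewrite mulrDr (cj z) // addr0; apply/eqP; rewrite -memv0 -(B0 j.+1).
  rewrite memv_cap (BM 1%N) //=; apply: (subvP (@ideal_pow_mono _ _ m j.+2 4 _)) => //.
  rewrite -socle_pow4; apply/annihilatorP => t tm; rewrite -mulrA cj //.
  rewrite mulrC ideal_powSr memv_mul // (subvP _ _ yj) //.
  by rewrite -[P j]BP addvSl.
have cm : c \in P 4.
  rewrite -socle_pow4; apply/annihilatorP => x xm.
  by apply: (low 1%N) => //; [apply: low | rewrite ideal_pow1].
have : c \in (B 1%N :&: P 2)%VS.
  by rewrite memv_cap c1 (subvP (@ideal_pow_mono _ _ m 2 4 _)).
by rewrite B0 memv0 acd => /eqP ->; rewrite add0r.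
Qed.

(** * The case h1 = h3 with h2 maximal *)

Section Compressed.
Hypotheses (h13 : h1 = h3) (h2E : h2 = 'C(h1.+1, 2)).

Lemma ann_pow3 : annihilator (P 3) = P 2.
Proof.
have [_ _ _ d2 _] := hilb4_dims.
apply/eqP; rewrite eq_sym eqEdim pow2_ann dim_ann_pow3 d2 h13; lia.
Qed.

(** B^2 has dimension at most the binomial h2 = dim m^2 / m^3 and spans this quotient, which leaves
    no room for an intersection. The bound on dim B is an inequality because B will also be the
    image [B'] of a complement. *)
Lemma sqv_direct B : (B + P 2 = m)%VS -> (\dim B <= h1)%N ->
  (B * B :&: P 3 = 0)%VS.
Proof.
move=> BP dB; have [_ _ d3 d2 _] := hilb4_dims.
apply/eqP; rewrite -dimv_eq0; have := dimv_sum_cap (B * B) (P 3).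
have -> : (B * B + P 3 = P 2)%VS by rewrite -(generators 2 BP) expv2.
have := dim_sqv B; have : ('C((\dim B).+1, 2) <= h2)%N.
  by rewrite h2E leq_bin2l.
rewrite d2 d3; lia.
Qed.

(* The generators x are replaced by x + U x with U x in m^2 chosen so that
   phi (U x * a) = - phi (x * a) / 3 for a in B^2; this is possible because
   B^2 is a complement of m^3 = 0 : m^2 in m^2, and it makes phi vanish on
   the products of three generators. *)
Lemma compressed_grading : 3%:R != 0 :> K -> exists B, grading m B.
Proof.
move=> char3; have [P5 d4 d3 d2 [d1 dA]] := hilb4_dims.
have [phi nd phi_soc] := gorenstein_form mI P5 gor.
have P2m : (P 2 <= m)%VS by rewrite -[X in (_ <= X)%VS](ideal_pow1 mI) ideal_powS.
have [B [BP BP0 dB]] := complement_sq.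
have Bm : (B <= m)%VS by rewrite -BP addvSl.
have BB0 : (B * B :&: P 3 = 0)%VS by rewrite sqv_direct ?dB.
(* U is the adjoint of -1/3 times the projection onto B^2 along m^3. The projection vanishes on m^3,
   so U takes its values in 0 : m^3 = m^2. *)
have [U Uphi] := form_transpose nd (- 3%:R^-1 *: daddv_pi (B * B) (P 3))%VF.
have UP x : U x \in P 2.
  rewrite -ann_pow3; apply/annihilatorP => a a3; apply: nd => b.
  have ab3 : a * b \in P 3 by rewrite mulrC ideal_pow_mul.
  rewrite -mulrA Uphi scale_lfunE.
  have -> : daddv_pi (B * B) (P 3) (a * b) = 0.
    apply/eqP; rewrite -memv0 -BB0 memv_cap memv_pi /=.
    have /(canRL (addrK _)) -> := daddv_pi_add BB0 (subvP (addvSr _ _) _ ab3).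
    by rewrite memvB // memv_pi.
  by rewrite scaler0 mulr0 linear0.
have Uphi_sq x y z : y \in B -> z \in B ->
    phi (U x * (y * z)) = - 3%:R^-1 *: phi (x * (y * z)).
  move=> yB zB; rewrite Uphi scale_lfunE daddv_pi_id ?memv_mul //.
  by rewrite -scalerAr linearZ.
pose V := (\1 + U)%VF; pose B' := (V @: B)%VS.
have VE x : V x = x + U x by rewrite add_lfunE id_lfunE.
have BP' : (B' + P 2 = m)%VS.
  apply: subv_anti; rewrite subv_add P2m andbT.
  apply/andP; split.
    apply/subvP => _ /memv_imgP[x xB ->]; rewrite VE memvD //; first exact: (subvP Bm).
    exact: (subvP P2m).
  apply/subvP => a; rewrite -{1}BP => /memv_addP[x xB [c c2 ->]].
  have -> : x + c = V x + (c - U x) by rewrite VE [RHS]addrACA subrr addr0.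
  by rewrite memv_add ?memv_img // memvB.
have dB' : (\dim B' <= h1)%N.
  by rewrite -dB -(limg_ker_dim V B) leq_addl.
have P1B x : x \in B -> x \in P 1 by rewrite ideal_pow1 //; apply: (subvP Bm).
have phi3 a : a \in (B' ^+ 3)%VS -> phi a = 0.
  suff /subvP sub : (B' ^+ 3 <= lker phi)%VS.
    by move=> /sub; rewrite memv_ker => /eqP.
  rewrite expvSr expv2; apply/prodvP => a' _ a'BB /memv_imgP[z zB ->].
  suff /subvP/(_ _ a'BB) : (B' * B' <= lker (phi \o amulr (V z)))%VS.
    by rewrite !memv_ker comp_lfunE lfunE.
  apply/prodvP => _ _ /memv_imgP[x xB ->] /memv_imgP[y yB ->].
  rewrite memv_ker comp_lfunE lfunE /= !VE.
  have PV w : w \in B -> w + U w \in P 1.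
    by move=> wB; rewrite memvD ?(P1B _ wB) // (subvP (ideal_powS m 1)).
  (* The terms with at least two values of U lie in m^5 = 0. Each of the three terms with one value
     contributes -1/3 of phi (x y z), and together they cancel the first term. *)
  have -> : (x + U x) * (y + U y) * (z + U z)
      = x * (y * z) + (U x * (y * z) + U y * (x * z) + U z * (x * y))
        + (U x * (U y * (z + U z)) + U x * (U z * y) + U y * (U z * x)) by ring.
  have U2 w w' v : v \in P 1 -> U w * (U w' * v) = 0.
    by move=> v1; rewrite (@pow_mul0 2 3) // (@mem_ideal_powM _ _ _ 2 1).
  rewrite !U2 ?PV ?P1B // !addr0 !linearD /= !Uphi_sq //.
  rewrite [y * (x * z)]mulrCA [z * (x * y)]mulrC -[x * y * z]mulrA.
  apply/eqP; move: (phi _) => p.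
  have third : - 3%:R^-1 * p + - 3%:R^-1 * p + - 3%:R^-1 * p = - p :> K.
    by field.
  by rewrite [X in _ + X]third subrr.
exists (fun k => B' ^+ k)%VS; split.
- exact: memv_line.
- by move=> i j a b ai bj; rewrite expvD memv_mul.
- by move=> k; apply: generators.
(* Degree 3 is the one that needs the correction: phi vanishes on B'^3 but on no nonzero element of
   the socle m^4. From degree 4 on, m^(k+1) = 0. *)
case=> [|[|[|[|k]]]].
- apply/eqP; rewrite -subv0 ideal_pow1 //; apply/subvP => a.
  rewrite memv_cap memv0 => /andP[/vlineP[k ->] km].
  have [->|k0] := eqVneq k 0; first by rewrite scale0r.
  have : k^-1 *: k%:A \in m by rewrite memvZ.
  by rewrite scalerA mulVf // scale1r (negPf one_notin).
- apply/eqP; rewrite -subv0; apply/subvP => a; rewrite memv_cap.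
  case/andP => /memv_imgP[x xB ->]; rewrite VE => xU.
  suff -> : x = 0 by rewrite linear0 addr0 mem0v.
  apply/eqP; rewrite -memv0 -BP0 memv_cap xB -[x](addrK (U x)).
  by rewrite memvB.
- by rewrite expv2 sqv_direct.
- apply/eqP; rewrite -subv0; apply/subvP => a; rewrite memv_cap memv0.
  case/andP => /phi3 phia; rewrite -socle_pow4 => /phi_soc -> //.
have /eqP -> : P k.+4.+1 == 0%VS by rewrite -subv0 -P5 ideal_pow_mono.
by rewrite capv0.
Qed.
End Compressed.
End SocleDegreeFour.

(** * Algebras that are quotients of power series rings *)

Section ArtinianLocal.
Variables (K : fieldType) (A : comFalgType K) (m : {vspace A}).
Hypotheses (mI : is_ideal m) (mK : forall a : A, exists k : K, a - k%:A \in m).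
Variables (N : nat) (PN : ideal_pow m N = 0%VS).

Let r := \dim m.
Let X (i : 'I_r) : A := (vbasis m)`_i.
Let ev : {mpoly K[r]} -> A := mmap (in_alg A) X.

Let mmap1_mem (k : 'X_{1..r}) : mmap1 X k \in ideal_pow m (mdeg k).
Proof.
rewrite /mmap1 mdegE.
elim/big_rec2: _ => [|i a d _ ad]; first exact: mem_ideal_pow0.
apply: mem_ideal_powM => //; rewrite -[d in ideal_pow m d]mul1n.
apply: exp_mem_ideal_pow; rewrite ideal_pow1 // vbasis_mem // mem_nth //.
by rewrite size_tuple.
Qed.

Let ev_eq (g g' : {mpoly K[r]}) :
  (forall k, (mdeg k < N)%N -> g@_k = g'@_k) -> ev g = ev g'.
Proof.
move=> gg'; apply/eqP; rewrite -subr_eq0 -raddfB /=; apply/eqP.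
rewrite /ev /mmap big1 // => k _; case: (ltnP (mdeg k) N) => [kN|Nk].
  by rewrite mcoeffB gg' // subrr raddf0 mul0r.
have := subvP (ideal_pow_mono m Nk) _ (mmap1_mem k).
by rewrite PN memv0 => /eqP ->; rewrite mulr0.
Qed.

(** Power series are evaluated at a basis of m; as m^N = 0, only the terms of degree below N count.
    With a basis of m, rather than a minimal set of generators, polynomials of degree at most 1
    already reach all of A. *)
Lemma nilpotent_artinian_local : artinian_local A.
Proof.
pose f (p : powser r K) : A := ev (pstrunc N p).
have fL : linear f.
  move=> c p q; rewrite /f.
  rewrite (@ev_eq _ (c *: pstrunc N p + pstrunc N q)) => [|k kN].
    by rewrite /ev mmapD mmapZ /= mulr_algl.
  by rewrite mcoeffD mcoeffZ !pstruncE.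
have fM : monoid_morphism f.
  split=> [|p q]; rewrite /f.
    rewrite (@ev_eq _ 1) => [|k kN]; first exact: rmorph1.
    by rewrite mcoeff1 pstruncE.
  rewrite -[RHS]rmorphM; apply: ev_eq => k kN.
  by rewrite pstruncE // (psmulE _ _ kN).
pose L := GRing.isLinear.Build K (powser r K) A _ f fL.
pose M := GRing.isMonoidMorphism.Build _ _ f fM.
pose ff : {lrmorphism powser r K -> A} := HB.pack f L M.
exists r, ff => a; have [c ac] := mK a.
pose g : {mpoly K[r]} := c%:MP + \sum_i coord (vbasis m) i (a - c%:A) *: 'X_i.
exists (PowSer (fun k => g@_k)); rewrite /= /f (@ev_eq _ g) => [|k kN].
  rewrite /ev mmapD mmapC raddf_sum /=.
  rewrite -[RHS](subrK c%:A) addrC; congr (_ + _).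
  rewrite [RHS](coord_vbasis ac); apply: eq_bigr => i _.
  by rewrite mmapZ mmapX mmap1U /= mulr_algl.
by rewrite pstruncE.
Qed.

End ArtinianLocal.

(** * The algebra of a quartic and a cubic form *)

(** Turns identities between vectors into identities between scalars, to which [ring] applies. *)
Lemma functional_ext (K : fieldType) (V : vectType K) (u v : V) :
  (forall f : 'Hom(V, K^o), f u = f v) -> u = v.
Proof.
move=> fuv; apply/eqP; rewrite -subr_eq0; apply/negPn/negP.
by case/exists_functional=> f; rewrite linearB /= fuv subrr eqxx.
Qed.

(* The data of the quartic form beta (mu u v) (mu w x) on V, where W is the
   quotient of S^2 V by the quadrics that annihilate it, and of the cubic form
   cub on V. *)
Record quartic_data (K : fieldType) (V W : vectType K) := QuarticData {
  mu : V -> V -> W;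
  beta : W -> W -> K;
  cub : V -> V -> V -> K;
  muC : forall u v, mu u v = mu v u;
  mu_linear : forall k u v w, mu u (k *: v + w) = k *: mu u v + mu u w;
  betaC : forall w x, beta w x = beta x w;
  beta_linear : forall k u v w, beta u (k *: v + w) = k * beta u v + beta u w;
  quartic_swap : forall u v w x, beta (mu u v) (mu w x) = beta (mu u w) (mu v x);
  cubC : forall u v w, cub u v w = cub v u w;
  cub_swap : forall u v w, cub u v w = cub u w v;
  cub_linear : forall k u v w x, cub u v (k *: w + x) = k * cub u v w + cub u v x
}.

Section Algebra.
Variables (K : fieldType) (V W : vectType K) (D : quartic_data V W).
Local Notation mu := (mu D).
Local Notation beta := (beta D).
Local Notation cub := (cub D).

Lemma muDr u v w : mu u (v + w) = mu u v + mu u w.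
Proof. by have := mu_linear D 1 u v w; rewrite !scale1r. Qed.
Lemma mu0r u : mu u 0 = 0.
Proof. by apply: (addrI (mu u 0)); rewrite -muDr !addr0. Qed.
Lemma muZr k u v : mu u (k *: v) = k *: mu u v.
Proof. by rewrite -[k *: v]addr0 mu_linear mu0r addr0. Qed.
Lemma muDl u v w : mu (v + w) u = mu v u + mu w u.
Proof. by rewrite !(muC _ _ u) muDr. Qed.
Lemma muZl k u v : mu (k *: v) u = k *: mu v u.
Proof. by rewrite !(muC _ _ u) muZr. Qed.

Lemma betaDr u v w : beta u (v + w) = beta u v + beta u w.
Proof. by have := beta_linear D 1 u v w; rewrite !scale1r mul1r. Qed.
Lemma beta0r u : beta u 0 = 0.
Proof. by apply: (addrI (beta u 0)); rewrite -betaDr !addr0. Qed.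
Lemma betaZr k u v : beta u (k *: v) = k * beta u v.
Proof. by rewrite -[k *: v]addr0 beta_linear beta0r addr0. Qed.
Lemma betaDl u v w : beta (v + w) u = beta v u + beta w u.
Proof. by rewrite !(betaC _ _ u) betaDr. Qed.
Lemma betaZl k u v : beta (k *: v) u = k * beta v u.
Proof. by rewrite !(betaC _ _ u) betaZr. Qed.

Lemma cubDr u v w x : cub u v (w + x) = cub u v w + cub u v x.
Proof. by have := cub_linear D 1 u v w x; rewrite !scale1r mul1r. Qed.
Lemma cub0r u v : cub u v 0 = 0.
Proof. by apply: (addrI (cub u v 0)); rewrite -cubDr !addr0. Qed.
Lemma cubZr k u v w : cub u v (k *: w) = k * cub u v w.
Proof. by rewrite -[k *: w]addr0 cub_linear cub0r addr0. Qed.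
Lemma cubDm u v w x : cub u (w + x) v = cub u w v + cub u x v.
Proof. by rewrite !(cub_swap _ _ _ v) cubDr. Qed.
Lemma cubZm k u v w : cub u (k *: w) v = k * cub u w v.
Proof. by rewrite !(cub_swap _ _ _ v) cubZr. Qed.
Lemma cubDl u v w x : cub (w + x) u v = cub w u v + cub x u v.
Proof. by rewrite !(cubC _ _ u) cubDm. Qed.
Lemma cubZl k u v w : cub (k *: w) u v = k * cub w u v.
Proof. by rewrite !(cubC _ _ u) cubZm. Qed.

(** The algebra will have the dual of V in degree 3. This functional is the product there of v in
    degree 1 and w in degree 2. *)
Definition contract_fun v w u : K^o := beta w (mu v u).
Fact contract_linear v w : linear (contract_fun v w).
Proof. by move=> k x y; rewrite /contract_fun muDr muZr betaDr betaZr. Qed.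
HB.instance Definition _ v w :=
  GRing.isLinear.Build K V K^o _ (contract_fun v w) (contract_linear v w).
Definition contract v w : 'Hom(V, K^o) := linfun (contract_fun v w).

Definition cubic_fun v w u : K^o := cub v w u.
Fact cubic_linear v w : linear (cubic_fun v w).
Proof. by move=> k x y; rewrite /cubic_fun cubDr cubZr. Qed.
HB.instance Definition _ v w :=
  GRing.isLinear.Build K V K^o _ (cubic_fun v w) (cubic_linear v w).
Definition cubic v w : 'Hom(V, K^o) := linfun (cubic_fun v w).

Lemma contractE v w u : contract v w u = beta w (mu v u).
Proof. by rewrite lfunE. Qed.
Lemma cubicE v w u : cubic v w u = cub v w u.
Proof. by rewrite lfunE. Qed.

(* The local algebra whose Macaulay inverse system is generated by the sum of
   the quartic and the cubic form of D. *)
Definition alg & quartic_data V W : Type :=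
  (K^o * V * W * 'Hom(V, K^o) * K^o)%type.
Local Notation A := (alg D).
HB.instance Definition _ := Vector.copy A (K^o * V * W * 'Hom(V, K^o) * K^o)%type.

Definition mkalg (a : K) (v : V) (w : W) (f : 'Hom(V, K^o)) (c : K) : A :=
  (a, v, w, f, c).
Definition part0 (x : A) : K := x.1.1.1.1.
Definition part1 (x : A) : V := x.1.1.1.2.
Definition part2 (x : A) : W := x.1.1.2.
Definition part3 (x : A) : 'Hom(V, K^o) := x.1.2.
Definition part4 (x : A) : K := x.2.

(** Without [cubic] this is a graded product; that term gives the product of two elements of degree
    1 an extra part in degree 3. *)
Definition algmul (x y : A) : A := mkalg
  (part0 x * part0 y)
  (part0 x *: part1 y + part0 y *: part1 x)
  (part0 x *: part2 y + part0 y *: part2 x + mu (part1 x) (part1 y))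
  (part0 x *: part3 y + part0 y *: part3 x
    + (contract (part1 x) (part2 y) + contract (part1 y) (part2 x)
       + cubic (part1 x) (part1 y)))
  (part0 x * part4 y + part0 y * part4 x
    + (part3 x (part1 y) + part3 y (part1 x) + beta (part2 x) (part2 y))).

Lemma algP (x y : A) : part0 x = part0 y -> part1 x = part1 y -> part2 x = part2 y ->
  part3 x = part3 y -> part4 x = part4 y -> x = y.
Proof.
case: x => [[[[a v] w] f] c]; case: y => [[[[a' v'] w'] f'] c'].
by rewrite /part0 /part1 /part2 /part3 /part4 /= => -> -> -> -> ->.
Qed.

Lemma functionalDl (f g : 'Hom(V, K^o)) u : (f + g) u = f u + g u :> K.
Proof. by rewrite [LHS]add_lfunE. Qed.
Lemma functionalZl (f : 'Hom(V, K^o)) k u : (k *: f) u = k * f u :> K.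
Proof. by rewrite [LHS]scale_lfunE. Qed.
Lemma functionalD (U : vectType K) (f : 'Hom(U, K^o)) u v :
  f (u + v) = f u + f v :> K.
Proof. by rewrite [LHS]linearD. Qed.
Lemma functionalZ (U : vectType K) (f : 'Hom(U, K^o)) k u :
  f (k *: u) = k * f u :> K.
Proof. by rewrite [LHS]linearZ. Qed.

Local Notation simp := (contractE, cubicE, functionalDl, functionalZl, functionalD,
  functionalZ, muDl, muDr, muZl, muZr, betaDl, betaDr,
  betaZl, betaZr, cubDl, cubDm, cubDr, cubZl, cubZm, cubZr).

Lemma algmulC : commutative algmul.
Proof.
move=> x y; apply: algP; rewrite /algmul /part0 /part1 /part2 /part3 /part4 /=.
- exact: mulrC.
- exact: addrC.
- by rewrite muC [X in X + _]addrC.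
- apply/lfunP => u; rewrite !simp.
  by rewrite (cubC _ (y.1.1.1.2)); ring.
- by rewrite betaC; ring.
Qed.

(** In degree 3 associativity rests on the symmetry of the quartic form, [quartic_swap], and in
    degree 4 on that of the cubic form. *)
Lemma algmulA : associative algmul.
Proof.
move=> x y z; apply: algP; rewrite /algmul /part0 /part1 /part2 /part3 /part4 /=.
- exact: mulrA.
- by apply: functional_ext => f; rewrite !simp; ring.
- by apply: functional_ext => f; rewrite !simp; ring.
- apply/lfunP => u; rewrite !simp.
  rewrite (quartic_swap _ (y.1.1.1.2)) (muC _ (y.1.1.1.2) (x.1.1.1.2)).
  ring.
rewrite !simp (muC _ (z.1.1.1.2) (x.1.1.1.2)) (muC _ (y.1.1.1.2) (x.1.1.1.2)).
rewrite (betaC _ (mu _ _) (z.1.1.2)) (cub_swap _ (y.1.1.1.2)) (cubC _ (y.1.1.1.2)).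
ring.
Qed.

Definition algone : A := mkalg 1 0 0 0 0.

Lemma contract0r v : contract v 0 = 0.
Proof. by apply/lfunP => u; rewrite contractE betaC beta0r zero_lfunE. Qed.
Lemma contract0l w : contract 0 w = 0.
Proof. by apply/lfunP => u; rewrite contractE muC mu0r beta0r zero_lfunE. Qed.
Lemma cubic0l v : cubic 0 v = 0.
Proof. by apply/lfunP => u; rewrite cubicE cubC cub_swap cub0r zero_lfunE. Qed.
Lemma cubic0r v : cubic v 0 = 0.
Proof. by apply/lfunP => u; rewrite cubicE cub_swap cub0r zero_lfunE. Qed.
Lemma beta0l w : beta 0 w = 0. Proof. by rewrite betaC beta0r. Qed.
Lemma mu0l v : mu 0 v = 0. Proof. by rewrite muC mu0r. Qed.

Local Notation simp0 := (contract0r, contract0l, cubic0r, cubic0l, mu0l, mu0r,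
  beta0l, beta0r, zero_lfunE, (linear0, (scale0r, scaler0)), (mul0r, mulr0),
  (add0r, addr0)).

Lemma algmul1 : left_id algone algmul.
Proof.
move=> x; apply: algP; rewrite /algmul /part0 /part1 /part2 /part3 /part4 /= ?simp0;
  by rewrite ?mul1r ?scale1r.
Qed.

Lemma algmulDl : left_distributive algmul +%R.
Proof.
move=> x y z; apply: algP; rewrite /algmul /part0 /part1 /part2 /part3 /part4 /=.
- by rewrite mulrDl.
- by apply: functional_ext => f; rewrite !simp; ring.
- by apply: functional_ext => f; rewrite !simp; ring.
- by apply/lfunP => u; rewrite !simp; ring.
by rewrite !simp; ring.
Qed.

Lemma algone_neq0 : algone != 0.
Proof. by apply/eqP => /(congr1 part0)/eqP; rewrite oner_eq0. Qed.

HB.instance Definition _ := GRing.Zmodule_isComNzRing.Build A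
  algmulA algmulC algmul1 algmulDl algone_neq0.

Lemma algscaleAl k (x y : A) : k *: (x * y) = (k *: x) * y.
Proof.
have kE (a : K) : k *: (a : K^o) = k * a by [].
rewrite -![_ * _]/(algmul _ _) /algmul; apply: algP;
  rewrite /part0 /part1 /part2 /part3 /part4 /= ?kE.
- exact: mulrA.
- by apply: functional_ext => f; rewrite !simp; ring.
- by apply: functional_ext => f; rewrite !simp; ring.
- by apply/lfunP => u; rewrite !simp; ring.
by rewrite !simp; ring.
Qed.

HB.instance Definition _ := GRing.Lmodule_isLalgebra.Build K A algscaleAl.
HB.instance Definition _ := GRing.Lalgebra_isComAlgebra.Build K A.
HB.instance Definition _ := Algebra_isFalgebra.Build K A.
End Algebra.

(** By the separation X embeds into the dual of U, so dim U >= dim X >= dim Y. *)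
Lemma separating_full (K : fieldType) (X Y : vectType K)
    (b : X -> 'Hom(Y, K^o)) (U : {vspace Y}) :
  linear b -> (dim Y <= dim X)%N ->
  (forall x, (forall y, y \in U -> b x y = 0) -> x = 0) -> U = fullv.
Proof.
move=> b_lin dYX b_inj.
pose T x : 'rV[K]_(\dim U) := \row_i b x (vbasis U)`_i.
have T_lin : linear T.
  by move=> k x y; apply/rowP => i; rewrite !mxE b_lin add_lfunE scale_lfunE.
pose TL := GRing.isLinear.Build K X _ _ T T_lin.
pose Tl : {linear X -> 'rV[K]_(\dim U)} := HB.pack T TL.
apply/eqP; rewrite eqEdim subvf dimvf (leq_trans dYX) //.
have : lker (linfun Tl) = 0%VS.
  apply/eqP; rewrite -subv0; apply/subvP => x; rewrite memv_ker lfunE memv0 /=.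
  move=> /eqP/rowP Tx; apply/eqP/b_inj => y yU; rewrite (coord_vbasis yU).
  rewrite linear_sum big1 // => i _; have := Tx i; rewrite !mxE linearZ /= => ->.
  by rewrite scaler0.
move=> ker0; have := dimvS (subvf (limg (linfun Tl))).
rewrite limg_dim_eq ?ker0 ?capv0 // !dimvf dim_matrix mul1r //.
Qed.

Lemma dim_lker_onto (K : fieldType) (X Y : vectType K) (f : {linear X -> Y}) :
  (forall y, exists x, f x = y) -> \dim (lker (linfun f)) = (dim X - dim Y)%N.
Proof.
move=> f_onto; have := limg_ker_dim (linfun f) fullv; rewrite capfv dimvf.
have -> : limg (linfun f) = fullv.
  apply/vspaceP => y; rewrite memvf; have [x <-] := f_onto y.
  by apply/memv_imgP; exists x; rewrite ?memvf ?lfunE.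
by rewrite dimvf => <-; rewrite addnK.
Qed.

(** * Powers of the maximal ideal, socle and Hilbert function *)

Section AlgebraProperties.
Variables (K : fieldType) (V W : vectType K) (D : quartic_data V W).
Local Notation mu := (mu D).
Local Notation beta := (beta D).
Local Notation cub := (cub D).
Local Notation A := (alg D).
Local Notation part0 := (@part0 _ _ _ D).
Local Notation part1 := (@part1 _ _ _ D).
Local Notation part2 := (@part2 _ _ _ D).
Local Notation part3 := (@part3 _ _ _ D).
Local Notation part4 := (@part4 _ _ _ D).

Definition beta_fun w x : K^o := beta w x.
Fact beta_fun_linear w : linear (beta_fun w).
Proof. by move=> k u v; rewrite /beta_fun betaDr betaZr. Qed.
HB.instance Definition _ w :=
  GRing.isLinear.Build K W K^o _ (beta_fun w) (@beta_fun_linear w).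
Definition eval_fun u (f : 'Hom(V, K^o)) : K^o := f u.
Fact eval_fun_linear u : linear (eval_fun u).
Proof. by move=> k f g; rewrite /eval_fun add_lfunE scale_lfunE. Qed.
HB.instance Definition _ u :=
  GRing.isLinear.Build K _ K^o _ (eval_fun u) (@eval_fun_linear u).

Definition trunc0 (x : A) : K^o := x.1.1.1.1.
Definition trunc1 (x : A) : (K^o * V)%type := x.1.1.1.
Definition trunc2 (x : A) : (K^o * V * W)%type := x.1.1.
Definition trunc3 (x : A) : (K^o * V * W * 'Hom(V, K^o))%type := x.1.
Fact trunc0_linear : linear trunc0. Proof. by []. Qed.
Fact trunc1_linear : linear trunc1. Proof. by []. Qed.
Fact trunc2_linear : linear trunc2. Proof. by []. Qed.
Fact trunc3_linear : linear trunc3. Proof. by []. Qed.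
HB.instance Definition _ := GRing.isLinear.Build K A _ _ trunc0 trunc0_linear.
HB.instance Definition _ := GRing.isLinear.Build K A _ _ trunc1 trunc1_linear.
HB.instance Definition _ := GRing.isLinear.Build K A _ _ trunc2 trunc2_linear.
HB.instance Definition _ := GRing.isLinear.Build K A _ _ trunc3 trunc3_linear.

Definition algmax : {vspace A} := lker (linfun trunc0).
(** The elements of order at least 2, 3 and 4; these spaces turn out to be m^2, m^3 and m^4. *)
Let U2 := lker (linfun trunc1).
Let U3 := lker (linfun trunc2).
Let U4 := lker (linfun trunc3).

Lemma algmaxP x : reflect (part0 x = 0) (x \in algmax).
Proof. by rewrite memv_ker lfunE; apply: eqP. Qed.
Let U2P x : reflect (part0 x = 0 /\ part1 x = 0) (x \in U2).
Proof.
rewrite memv_ker lfunE; apply: (iffP eqP) => /=; rewrite /trunc1 /part0 /part1.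
  by move=> ->.
by case: x.1.1.1 => a v /= [-> ->].
Qed.
Let U3P x : reflect [/\ part0 x = 0, part1 x = 0 & part2 x = 0] (x \in U3).
Proof.
rewrite memv_ker lfunE; apply: (iffP eqP) => /=; rewrite /trunc2 /part0 /part1 /part2.
  by move=> ->.
by case: x.1.1 => [[a v] w] /= [-> -> ->].
Qed.
Let U4P x : reflect [/\ part0 x = 0, part1 x = 0, part2 x = 0 & part3 x = 0] (x \in U4).
Proof.
rewrite memv_ker lfunE; apply: (iffP eqP) => /=; rewrite /trunc3 /part0 /part1 /part2 /part3.
  by move=> ->.
by case: x.1 => [[[a v] w] f] /= [-> -> -> ->].
Qed.

Lemma algmulE (x y : A) : x * y = mkalg D
  (part0 x * part0 y)
  (part0 x *: part1 y + part0 y *: part1 x)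
  (part0 x *: part2 y + part0 y *: part2 x + mu (part1 x) (part1 y))
  (part0 x *: part3 y + part0 y *: part3 x
    + (contract D (part1 x) (part2 y) + contract D (part1 y) (part2 x)
       + cubic D (part1 x) (part1 y)))
  (part0 x * part4 y + part0 y * part4 x
    + (part3 x (part1 y) + part3 y (part1 x) + beta (part2 x) (part2 y))).
Proof. by []. Qed.

Definition incl1 v : A := mkalg D 0 v 0 0 0.
Definition incl2 w : A := mkalg D 0 0 w 0 0.
Definition incl3 f : A := mkalg D 0 0 0 f 0.
Definition incl4 c : A := mkalg D 0 0 0 0 c.

Fact incl2_linear : linear incl2.
Proof.
by move=> k v w; apply: algP; rewrite /part0 /part1 /part2 /part3 /part4 //= ?scaler0 ?addr0.
Qed.
Fact incl3_linear : linear incl3.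
Proof.
by move=> k v w; apply: algP; rewrite /part0 /part1 /part2 /part3 /part4 //= ?scaler0 ?addr0.
Qed.
HB.instance Definition _ := GRing.isLinear.Build K W A _ incl2 incl2_linear.
HB.instance Definition _ := GRing.isLinear.Build K _ A _ incl3 incl3_linear.

Local Notation simp0 := (contract0r, contract0l, cubic0r, cubic0l, mu0l, mu0r,
  beta0l, beta0r, zero_lfunE, (linear0, (scale0r, scaler0)), (mul0r, mulr0),
  (add0r, addr0)).

Let i11 u v : incl1 u * incl1 v = incl2 (mu u v) + incl3 (cubic D u v).
Proof.
rewrite algmulE; apply: algP; rewrite /part0 /part1 /part2 /part3 /part4 /= ?simp0 //.
Qed.
Let i12 v w : incl1 v * incl2 w = incl3 (contract D v w).
Proof.
rewrite algmulE; apply: algP; rewrite /part0 /part1 /part2 /part3 /part4 /= ?simp0 //.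
Qed.
Let i13 v f : incl1 v * incl3 f = incl4 (f v).
Proof.
rewrite algmulE; apply: algP; rewrite /part0 /part1 /part2 /part3 /part4 /= ?simp0 //.
Qed.

Let betaH w : 'Hom(W, K^o) := linfun (beta_fun w).
Let betaHE w x : betaH w x = beta w x. Proof. by rewrite lfunE. Qed.

Hypothesis mu_sep : forall w, (forall u v, beta w (mu u v) = 0) -> w = 0.
Hypothesis mu_inj : forall u, (forall v, mu u v = 0) -> u = 0.
Hypothesis V_gt0 : (0 < dim V)%N.

Let mu_full (U : {vspace W}) : (forall u v, mu u v \in U) -> U = fullv.
Proof.
move=> muU; apply: (@separating_full _ _ _ betaH) => // [k u v|w wU].
  apply/lfunP => x; rewrite add_lfunE scale_lfunE !betaHE.
  by rewrite betaDl betaZl.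
by apply: mu_sep => u v; rewrite -betaHE wU.
Qed.

Let ev u : 'Hom('Hom(V, K^o), K^o) := linfun (eval_fun u).
Let evE u f : ev u f = f u. Proof. by rewrite lfunE. Qed.

(** Degrees 1 and 2 generate degree 3: a vector u on which these functionals vanish has [mu v u] = 0
    for all v by [mu_sep], so u = 0 by [mu_inj]. *)
Let contract_full (U : {vspace 'Hom(V, K^o)}) :
  (forall v w, contract D v w \in U) -> U = fullv.
Proof.
move=> cU; apply: (@separating_full _ V _ ev) => // [k u v||u uU].
- by apply/lfunP => f; rewrite add_lfunE scale_lfunE !evE linearP.
- by rewrite -[X in (X <= _)%N]/(dim V * 1)%N muln1.
apply: mu_inj => v; apply: mu_sep => v' w.
by have := uU _ (cU v (mu v' w)); rewrite evE contractE betaC (muC _ v u).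
Qed.

Let mI : is_ideal algmax.
Proof.
move=> a x /algmaxP x0; apply/algmaxP; rewrite algmulE.
by rewrite -[LHS]/(part0 a * part0 x) x0 mulr0.
Qed.

Let algE (x : A) : part0 x = 0 ->
  x = incl1 (part1 x) + (incl2 (part2 x) + (incl3 (part3 x) + incl4 (part4 x))).
Proof.
move=> x0; apply: algP; rewrite -?x0 /part0 /part1 /part2 /part3 /part4 /= ?addr0 ?add0r //.
Qed.

Let i1m v : incl1 v \in algmax. Proof. exact/algmaxP. Qed.

Let U2m : (U2 <= algmax)%VS.
Proof. by apply/subvP => x /U2P[x0 _]; apply/algmaxP. Qed.
Let U32 : (U3 <= U2)%VS.
Proof. by apply/subvP => x /U3P[x0 x1 _]; apply/U2P. Qed.
Let v0_neq0 : exists v : V, v != 0.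
Proof.
exists (vpick fullv); rewrite vpick0 -dimv_eq0 dimvf.
by case: (dim V) V_gt0.
Qed.

Let i4_mem c : incl4 c \in (algmax * U3)%VS.
Proof.
have [v /exists_functional[f fv]] := v0_neq0.
have -> : incl4 c = (c / f v) *: (incl1 v * incl3 f).
  rewrite i13; apply: algP; rewrite /part0 /part1 /part2 /part3 /part4 //= ?simp0 //.
  by rewrite -[RHS]/(c / f v * f v) divfK.
by rewrite memvZ // memv_mul //; apply/U3P.
Qed.

Let i3_mem f : incl3 f \in (algmax * U2)%VS.
Proof.
suff pre_full : (linfun incl3 @^-1: (algmax * U2))%VS = fullv.
  by have := memvf f; rewrite -pre_full -memv_preim lfunE.
apply: contract_full => v w.
by rewrite -memv_preim lfunE /= -i12 memv_mul //; apply/U2P.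
Qed.

(** A product of two elements of degree 1 has a cubic part in degree 3, which [i3_mem] allows to
    subtract. *)
Let i2_mem w : incl2 w \in (algmax * algmax)%VS.
Proof.
suff pre_full : (linfun incl2 @^-1: (algmax * algmax))%VS = fullv.
  by have := memvf w; rewrite -pre_full -memv_preim lfunE.
apply: mu_full => u v.
rewrite -memv_preim lfunE /= -[incl2 _](addrK (incl3 (cubic D u v))) -i11.
by rewrite memvB ?memv_mul // (subvP (prodvSr _ U2m)) ?i3_mem.
Qed.

Let mU1 : (algmax * algmax)%VS = U2.
Proof.
apply: subv_anti; apply/andP; split.
  apply/prodvP => x y /algmaxP x0 /algmaxP y0; apply/U2P.
  by rewrite algmulE x0 y0 /part0 /part1 /= !simp0.
apply/subvP => x /U2P[x0 x1]; rewrite (algE x0) x1.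
have i3m : incl3 (part3 x) \in (algmax * algmax)%VS by rewrite (subvP (prodvSr _ U2m)).
have i4m : incl4 (part4 x) \in (algmax * algmax)%VS.
  by rewrite (subvP (prodvSr _ (subv_trans U32 U2m))).
by rewrite add0r !memvD.
Qed.

Let mU2 : (algmax * U2)%VS = U3.
Proof.
apply: subv_anti; apply/andP; split.
  apply/prodvP => x y /algmaxP x0 /U2P[y0 y1]; apply/U3P.
  by rewrite algmulE x0 y0 y1 /part0 /part1 /part2 /= !simp0.
apply/subvP => x /U3P[x0 x1 x2]; rewrite (algE x0) x1 x2.
have i4m : incl4 (part4 x) \in (algmax * U2)%VS by rewrite (subvP (prodvSr _ U32)).
by rewrite linear0 !add0r memvD.
Qed.

Let mU3 : (algmax * U3)%VS = U4.
Proof.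
apply: subv_anti; apply/andP; split.
  apply/prodvP => x y /algmaxP x0 /U3P[y0 y1 y2]; apply/U4P.
  by rewrite algmulE x0 y0 y1 y2 /part0 /part1 /part2 /part3 /= !simp0.
apply/subvP => x /U4P[x0 x1 x2 x3]; rewrite (algE x0) x1 x2 x3.
by rewrite !linear0 !add0r.
Qed.

Let mU4 : (algmax * U4)%VS = 0%VS.
Proof.
apply/eqP; rewrite -subv0; apply/prodvP => x y /algmaxP x0 /U4P[y0 y1 y2 y3].
rewrite memv0 algmulE x0 y0 y1 y2 y3 !simp0; apply/eqP.
by apply: algP; rewrite /part0 /part1 /part2 /part3 /part4.
Qed.

Let P1 : ideal_pow algmax 1 = algmax. Proof. exact: ideal_pow1. Qed.
Let P2 : ideal_pow algmax 2 = U2. Proof. by rewrite ideal_powSr P1 mU1. Qed.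
Let P3 : ideal_pow algmax 3 = U3. Proof. by rewrite ideal_powSr P2 mU2. Qed.
Let P4 : ideal_pow algmax 4 = U4. Proof. by rewrite ideal_powSr P3 mU3. Qed.
Let P5 : ideal_pow algmax 5 = 0%VS. Proof. by rewrite ideal_powSr P4 mU4. Qed.

Let algK (a : A) : exists k : K, a - k%:A \in algmax.
Proof.
exists (part0 a); apply/algmaxP.
by rewrite -[LHS]/(part0 a - part0 a * 1) mulr1 subrr.
Qed.

Lemma alg_artinian_local : artinian_local A.
Proof. exact: (nilpotent_artinian_local mI algK P5). Qed.

Let one_notin_algmax : 1 \notin algmax.
Proof. by apply/algmaxP => /eqP; rewrite oner_eq0. Qed.

Lemma algmax_maximal : is_maximal_ideal algmax.
Proof.
split=> // [mT|J JI mJ]; first by have := one_notin_algmax; rewrite mT memvf.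
have [Jm|/subvPn[x xJ /algmaxP/eqP x0]] := boolP (J <= algmax)%VS.
  by left; apply: subv_anti; rewrite Jm mJ.
right; suff J1 : 1 \in J by apply/vspaceP => a; rewrite memvf -[a]mulr1 JI.
have x1m : x - (part0 x)%:A \in algmax.
  by apply/algmaxP; rewrite -[LHS]/(part0 x - part0 x * 1) mulr1 subrr.
have -> : 1 = (part0 x)^-1 *: (x - (x - (part0 x)%:A)) :> A.
  by rewrite subKr scalerA mulVf // scale1r.
by rewrite memvZ // memvB // (subvP mJ).
Qed.

Let dim_algmax : \dim algmax = (dim V + dim W + dim V + 1)%N.
Proof.
rewrite dim_lker_onto => [|a]; last by exists (mkalg D a 0 0 0 0).
rewrite -[dim A]/(1 + dim V + dim W + dim V * 1 + 1)%N -[dim K^o]/1%N; lia.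
Qed.
Let dim_U2 : \dim U2 = (dim W + dim V + 1)%N.
Proof.
rewrite dim_lker_onto => [|[a v]]; last by exists (mkalg D a v 0 0 0).
rewrite -[dim A]/(1 + dim V + dim W + dim V * 1 + 1)%N.
rewrite -[X in (_ - X)%N]/(1 + dim V)%N; lia.
Qed.
Let dim_U3 : \dim U3 = (dim V + 1)%N.
Proof.
rewrite dim_lker_onto => [|[[a v] w]]; last by exists (mkalg D a v w 0 0).
rewrite -[dim A]/(1 + dim V + dim W + dim V * 1 + 1)%N.
rewrite -[X in (_ - X)%N]/(1 + dim V + dim W)%N; lia.
Qed.
Let dim_U4 : \dim U4 = 1%N.
Proof.
rewrite dim_lker_onto => [|[[[a v] w] f]]; last by exists (mkalg D a v w f 0).
rewrite -[dim A]/(1 + dim V + dim W + dim V * 1 + 1)%N.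
rewrite -[X in (_ - X)%N]/(1 + dim V + dim W + dim V * 1)%N; lia.
Qed.

(** Multiplying a socle element by degree 3 shows that its parts of degrees 0 and 1 vanish;
    multiplying by degree 1 then does the same for degrees 2 and 3. *)
Lemma alg_gorenstein : gorenstein algmax.
Proof.
rewrite /gorenstein -dim_U4; congr (\dim _).
apply: subv_anti; apply/andP; split; apply/subvP => x; last first.
  move=> x4; apply/annihilatorP => y ym; apply/eqP.
  by rewrite -memv0 -mU4 mulrC memv_mul.
move=> /annihilatorP xm; have [v v0] := v0_neq0.
have x13 (f : 'Hom(V, K^o)) : (part0 x *: f = 0) /\ f (part1 x) = 0.
  have f3m : incl3 f \in algmax by apply/algmaxP.
  have := xm _ f3m; rewrite algmulE => xf.
  by split; [have := congr1 part3 xf | have := congr1 part4 xf];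
    rewrite /part0 /part1 /part2 /part3 /part4 /= !simp0.
have x0 : part0 x = 0.
  have [f fv] := exists_functional v0; apply/eqP.
  have /eqP := (x13 f).1; rewrite scaler_eq0 => /orP[//|/eqP f0].
  by rewrite f0 zero_lfunE eqxx in fv.
have x1 : part1 x = 0.
  by apply: functional_ext => f; rewrite linear0 (x13 f).2.
have x11 u : contract D u (part2 x) = 0 /\ part3 x u = 0.
  have := xm (incl1 u) (i1m u); rewrite algmulE x0 x1 => xu.
  by split; [have := congr1 part3 xu | have := congr1 part4 xu];
    rewrite /part0 /part1 /part2 /part3 /part4 /= !simp0.
apply/U4P; split=> //.
  by apply: mu_sep => u w; rewrite -contractE (x11 u).1 zero_lfunE.
by apply/lfunP => u; rewrite zero_lfunE (x11 u).2.
Qed.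

Lemma alg_hilbert : hilbert_function algmax [:: 1; dim V; dim W; dim V; 1]%N.
Proof.
exists 4%N.
  split=> [|j Pj]; first by rewrite P4 => U40; have := dim_U4; rewrite U40 dimv0.
  rewrite leqNgt; apply/negP => j5; apply: Pj; apply/eqP.
  by rewrite -subv0 -P5 ideal_pow_mono.
have dA : \dim {:A} = (1 + dim V + dim W + dim V * 1 + 1)%N by rewrite dimvf.
rewrite /mkseq /= /hilb P5 P4 P3 P2 P1 ideal_pow0 dA dim_algmax dim_U2 dim_U3.
rewrite dim_U4 dimv0; congr [:: _; _; _; _; _]; lia.
Qed.

(* If A were graded, the degree 1 component b of y would satisfy b^2 = 0, as y^2
   is in m^3; but the coefficient of y in b^2 is cub y y y. *)
Lemma alg_not_canonically_graded y : mu y y = 0 -> cub y y y != 0 ->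
  ~ canonically_graded algmax.
Proof.
move=> yy yyy /(canonically_graded_grading mI one_notin_algmax algK P5).
case=> B [_ BM BP B0].
have y1 : incl1 y \in ideal_pow algmax 1 by rewrite P1.
have y2 : incl1 y * incl1 y \in ideal_pow algmax 3.
  by rewrite i11 yy linear0 add0r P3; apply/U3P.
have /memv_addP[b bB [c c2m ybc]] : incl1 y \in (B 1%N + ideal_pow algmax 2)%VS.
  by rewrite BP.
have bE : b = incl1 y - c by rewrite ybc addrK.
have b0 : b * b = 0.
  apply/eqP; rewrite -memv0 -(B0 2%N) memv_cap (BM 1%N 1%N) //=.
  have -> : b * b = incl1 y * incl1 y - (incl1 y * c + c * b) by rewrite bE; ring.
  rewrite memvB // memvD //; first exact: (@mem_ideal_powM _ _ _ 1 2).
  apply: (@mem_ideal_powM _ _ _ 2 1) => //.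
  by rewrite bE memvB // (subvP (ideal_powS _ 1)).
move: c2m; rewrite P2 => /U2P[c00 c10].
have cb0 : part0 b = 0 by rewrite bE -[LHS]/(0 - part0 c) c00 subrr.
have cb1 : part1 b = y by rewrite bE -[LHS]/(y - part1 c) c10 subr0.
(* At y the contractions pair with [mu y y] = 0, so only the cubic term remains. *)
have := congr1 (fun x => part3 x y) b0; rewrite algmulE cb0 cb1.
rewrite /part3 /= !functionalDl !contractE cubicE yy !simp0 => /eqP.
by rewrite (negPf yyy).
Qed.
End AlgebraProperties.

(** * Algebras that are not canonically graded *)

(* In divided powers, the quartic form is
     \sum_i x_i^[3] y + \sum_k z_k^[4] + \sum_p x_(p1 p)^[2] x_(p2 p)^[2],
   and the cubic form is y^[3]. *)
Section Example.
Variables (K : fieldType) (t s : nat) (S : finType) (p1 p2 : S -> 'I_t).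
Hypothesis p12 : forall p, (p1 p < p2 p)%N.
Hypothesis p_inj : injective (fun p => (p1 p, p2 p)).

Definition exV : vectType K :=
  ({ffun 'I_t -> K^o} * {ffun 'I_s -> K^o} * K^o)%type.
(** Coordinates with respect to the quadrics X_i^2, Z_k^2, X_i Y and X_(p1 p) X_(p2 p) in the dual
    variables; the other monomials of degree 2 annihilate the quartic. *)
Definition exW : vectType K :=
  ({ffun 'I_t -> K^o} * {ffun 'I_s -> K^o} * {ffun 'I_t -> K^o}
    * {ffun S -> K^o})%type.
Implicit Types (u v : exV) (w : exW).

Let x v (i : 'I_t) : K := v.1.1 i.
Let z v (k : 'I_s) : K := v.1.2 k.
Let y v : K := v.2.
Let a w (i : 'I_t) : K := w.1.1.1 i.
Let a' w (k : 'I_s) : K := w.1.1.2 k.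
Let b w (i : 'I_t) : K := w.1.2 i.
Let c w (p : S) : K := w.2 p.

Definition exmu u v : exW :=
  ([ffun i => x u i * x v i], [ffun k => z u k * z v k],
   [ffun i => x u i * y v + y u * x v i],
   [ffun p => x u (p1 p) * x v (p2 p) + x u (p2 p) * x v (p1 p)]).

Definition exbeta w w' : K :=
  \sum_i (a w i * b w' i + b w i * a w' i) + \sum_k a' w k * a' w' k
  + \sum_p (c w p * c w' p + a w (p1 p) * a w' (p2 p) + a w (p2 p) * a w' (p1 p)).

Definition excub u v v' : K := y u * y v * y v'.

Let exmuC u v : exmu u v = exmu v u.
Proof.
by congr (_, _, _, _); apply/ffunP => i; rewrite !ffunE; ring.
Qed.

Let exmu_linear k u v v' : exmu u (k *: v + v') = k *: exmu u v + exmu u v'.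
Proof.
have sE (l l' : K) : l *: (l' : K^o) = l * l' by [].
by congr (_, _, _, _); apply/ffunP => i; rewrite !ffunE /x /y /z /= ?ffunE !sE; ring.
Qed.

Let exbetaC w w' : exbeta w w' = exbeta w' w.
Proof.
by congr (_ + _ + _); apply: eq_bigr => i _; ring.
Qed.

Let exbeta_linear k w w1 w2 :
  exbeta w (k *: w1 + w2) = k * exbeta w w1 + exbeta w w2.
Proof.
have sE (l l' : K) : l *: (l' : K^o) = l * l' by [].
rewrite /exbeta !mulrDr !mulr_sumr.
rewrite [RHS]addrACA; congr (_ + _); first (rewrite [RHS]addrACA; congr (_ + _));
  rewrite -big_split; apply: eq_bigr => i _;
  rewrite /a /a' /b /c /= !ffunE !sE; ring.
Qed.

Let exquartic_swap u v u' v' :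
  exbeta (exmu u v) (exmu u' v') = exbeta (exmu u u') (exmu v v').
Proof.
by congr (_ + _ + _); apply: eq_bigr => i _; rewrite /a /a' /b /c /= !ffunE; ring.
Qed.

Definition exdata : quartic_data exV exW.
Proof.
apply: (@QuarticData K exV exW exmu exbeta excub) => //.
- by move=> u v v'; rewrite /excub [y u * _]mulrC.
- by move=> u v v'; rewrite /excub mulrAC.
- by move=> k u v u' v'; rewrite /excub -[y (_ + _)]/(k * y u' + y v'); ring.
Defined.

Let ex (i : 'I_t) : exV := ([ffun j => (j == i)%:R], 0, 0).
Let ez (k : 'I_s) : exV := (0, [ffun j => (j == k)%:R], 0).
Definition ey : exV := (0, 0, 1).

Lemma exmu_ey : mu exdata ey ey = 0.
Proof.
by congr (_, _, _, _); apply/ffunP => i; rewrite !ffunE /x /y /z /= !ffunE; ring.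
Qed.

Lemma excub_ey : cub exdata ey ey ey != 0.
Proof. by rewrite /= /excub /y /= !mulr1 oner_neq0. Qed.

Let sum_delta (T : finType) (F : T -> K) i : \sum_j F j * (j == i)%:R = F i.
Proof.
rewrite (bigD1 i) //= eqxx mulr1 big1 ?addr0 // => j /negPf ->.
by rewrite mulr0.
Qed.

Let beta_ex_ey w i : exbeta w (exmu (ex i) ey) = a w i.
Proof.
rewrite -[RHS]addr0 -[X in _ = X + _]addr0; congr (_ + _ + _).
- rewrite -[RHS]sum_delta; apply: eq_bigr => j _.
  by rewrite /a /b /= !ffunE /x /y /= !ffunE; ring.
- by rewrite big1 // => k _; rewrite /a' /= !ffunE /z /= !ffunE; ring.
by rewrite big1 // => p _; rewrite /a /c /= !ffunE /x /= !ffunE; ring.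
Qed.

Let beta_ez w k : exbeta w (exmu (ez k) (ez k)) = a' w k.
Proof.
rewrite -[RHS]addr0 -[X in _ = X + _]add0r; congr (_ + _ + _).
- by rewrite big1 // => i _; rewrite /a /b /= !ffunE /x /y /= !ffunE; ring.
- rewrite -[RHS]sum_delta; apply: eq_bigr => j _.
  by rewrite /a' /= !ffunE /z /= !ffunE; case: (j == k); rewrite ?mulr1 ?mulr0.
by rewrite big1 // => p _; rewrite /a /c /= !ffunE /x /= !ffunE; ring.
Qed.

Let beta_ex_ex w p : exbeta w (exmu (ex (p1 p)) (ex (p2 p))) = c w p.
Proof.
have neq i : (i == p1 p)%:R * (i == p2 p)%:R = 0 :> K.
  have [->|_] := eqVneq i; last by rewrite mul0r.
  by rewrite -val_eqE (ltn_eqF (p12 p)) mulr0.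
rewrite -[RHS]add0r -[X in _ = X + _]addr0; congr (_ + _ + _).
- by rewrite big1 // => i _; rewrite /a /b /= !ffunE /x /y /= !ffunE neq; ring.
- by rewrite big1 // => k _; rewrite /a' /= !ffunE /z /= !ffunE; ring.
rewrite -[RHS]sum_delta; apply: eq_bigr => q _.
rewrite /a /c /= !ffunE /x /= !ffunE !neq !mulr0 !addr0; congr (_ * _).
have -> : (q == p) = (p1 q == p1 p) && (p2 q == p2 p).
  by apply/eqP/andP => [-> //|[/eqP e1 /eqP e2]]; apply: p_inj; rewrite e1 e2.
have -> : (p2 q == p1 p)%:R * (p1 q == p2 p)%:R = 0 :> K.
  case: eqP => [e1|_]; last by rewrite mul0r.
  case: eqP => [e2|_]; last by rewrite mulr0.
  by have := p12 q; rewrite e1 e2 ltnNge ltnW ?p12.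
by rewrite addr0 -natrM mulnb.
Qed.

(** X_i^2 pairs with X_i Y, but also with X_j^2 when i and j form a chosen pair; the vanishing of
    the coordinates [a] removes the latter. *)
Let beta_ex w i : (forall j, a w j = 0) -> exbeta w (exmu (ex i) (ex i)) = b w i.
Proof.
move=> aw; rewrite -[RHS]addr0 -[X in _ = X + _]addr0; congr (_ + _ + _).
- rewrite -[RHS]sum_delta; apply: eq_bigr => j _.
  rewrite aw /a /b /= !ffunE /x /y /= !ffunE.
  by case: (j == i); rewrite ?mulr1 ?mulr0; ring.
- by rewrite big1 // => k _; rewrite /a' /= !ffunE /z /= !ffunE; ring.
rewrite big1 // => p _; rewrite !aw /c /= !ffunE /x /= !ffunE.
have -> : (p1 p == i)%:R * (p2 p == i)%:R = 0 :> K.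
  have [<-|_] := eqVneq (p1 p) i; last by rewrite mul0r.
  by rewrite -val_eqE (gtn_eqF (p12 p)) mulr0.
have -> : (p2 p == i)%:R * (p1 p == i)%:R = 0 :> K.
  have [<-|_] := eqVneq (p1 p) i; last by rewrite mulr0.
  by rewrite -val_eqE (gtn_eqF (p12 p)) mul0r.
by ring.
Qed.

Lemma exmu_sep w : (forall u v, beta exdata w (mu exdata u v) = 0) -> w = 0.
Proof.
move=> wmu.
have aw i : a w i = 0 by rewrite -beta_ex_ey; apply: wmu.
have bw i : b w i = 0 by rewrite -beta_ex //; apply: wmu.
have a'w k : a' w k = 0 by rewrite -beta_ez; apply: wmu.
have cw p : c w p = 0 by rewrite -beta_ex_ex; apply: wmu.
rewrite [w](_ : _ = (w.1.1.1, w.1.1.2, w.1.2, w.2)); last first.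
  by case: w {wmu aw bw a'w cw} => [[[]]].
by congr (_, _, _, _); apply/ffunP => i; rewrite ffunE;
  [exact: aw | exact: a'w | exact: bw | exact: cw].
Qed.

(** The coordinate y is only seen through the products X_i Y, whence the condition on t. *)
Lemma exmu_inj u : (0 < t)%N -> (forall v, mu exdata u v = 0) -> u = 0.
Proof.
move=> t0 umu.
have xu i : x u i = 0.
  have := congr1 (fun w => a w i) (umu (ex i)).
  by rewrite /a /= !ffunE /x /= !ffunE eqxx mulr1.
have zu k : z u k = 0.
  have := congr1 (fun w => a' w k) (umu (ez k)).
  by rewrite /a' /= !ffunE /z /= !ffunE eqxx mulr1.
have yu : y u = 0.
  have := congr1 (fun w => b w (Ordinal t0)) (umu (ex (Ordinal t0))).
  by rewrite /b /= !ffunE /x /y /= !ffunE eqxx mulr1 mulr0 add0r.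
rewrite [u](_ : _ = (u.1.1, u.1.2, u.2)); last first.
  by case: u {umu xu zu yu} => [[]].
by congr (_, _, _); [apply/ffunP => i; rewrite ffunE; apply: xu
  |apply/ffunP => k; rewrite ffunE; apply: zu | exact: yu].
Qed.

Lemma exalg_counterexample : (0 < t)%N ->
  exists (A : comFalgType K) (m : {vspace A}),
    [/\ artinian_local A, is_maximal_ideal m, gorenstein m,
        hilbert_function m [:: 1; t + s + 1; t + s + t + #|S|; t + s + 1; 1]%N
      & ~ canonically_graded m].
Proof.
move=> t0.
have dV : dim exV = (t + s + 1)%N.
  by rewrite -[LHS]/(#|'I_t| * 1 + #|'I_s| * 1 + 1)%N !card_ord !muln1.
have dW : dim exW = (t + s + t + #|S|)%N.
  by rewrite -[LHS]/(#|'I_t| * 1 + #|'I_s| * 1 + #|'I_t| * 1 + #|S| * 1)%N !card_ord !muln1.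
have V0 : (0 < dim exV)%N by rewrite dV addn1.
have inj u := @exmu_inj u t0.
exists (alg exdata), (algmax exdata); split.
- exact: alg_artinian_local exmu_sep inj V0.
- exact: algmax_maximal.
- exact: (alg_gorenstein exmu_sep V0).
- by rewrite -dV -dW; apply: alg_hilbert exmu_sep inj V0.
exact: (alg_not_canonically_graded exmu_sep inj V0 exmu_ey excub_ey).
Qed.
End Example.

(** * Choice of the numbers of variables and pairs *)

Lemma card_ltn_pairs t :
  #|[set q : 'I_t * 'I_t | (q.1 < q.2)%N]| = 'C(t, 2).
Proof.
rewrite cardE -sum1_size big_enum.
rewrite (eq_bigl (fun q : 'I_t * 'I_t => true && (q.1 < q.2)%N)) => [|q]; last first.
  by rewrite inE.
rewrite -(pair_big_dep xpredT (fun i j : 'I_t => (i < j)%N) (fun _ _ => 1%N)) /=.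
rewrite (exchange_big_dep xpredT) //= -bin2_sum big_mkord.
apply: eq_bigr => j _.
by rewrite (big_ord_narrow (ltnW (ltn_ord j))) sum1_card card_ord.
Qed.

Lemma noncanonical_example (K : fieldType) n h : (n <= h)%N -> (0 < n)%N ->
  (h < 'C(n.+1, 2))%N ->
  exists (A : comFalgType K) (m : {vspace A}),
    [/\ artinian_local A, is_maximal_ideal m, gorenstein m,
        hilbert_function m [:: 1; n; h; n; 1]%N & ~ canonically_graded m].
Proof.
case: n => // d nh _ hC.
have d0 : (0 < d)%N by case: d nh hC => // nh; rewrite binn; lia.
(* There are d = t + s variables besides y and W has dimension d + t + p, so t + p must be h - d; t
   is taken as large as d allows. *)
pose t := minn d (h - d); pose s := (d - t)%N; pose p := (h - d - t)%N.
(* If t < d then p = 0. If t = d, then h < C(d + 2, 2) = C(d, 2) + 2 d + 1 gives p <= C(d, 2). *)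
have pC : (p <= #|[set q : 'I_t * 'I_t | (q.1 < q.2)%N]|)%N.
  rewrite card_ltn_pairs /p /t; case: (leqP d (h - d)) => hd; last by lia.
  by move: hC; rewrite !binS !bin1 bin0; lia.
pose f (q : 'I_p) := enum_val (widen_ord pC q).
have f12 q : ((f q).1 < (f q).2)%N.
  by have := enum_valP (widen_ord pC q); rewrite inE.
have f_inj : injective (fun q => ((f q).1, (f q).2)).
  move=> q q'; rewrite -!surjective_pairing => /enum_val_inj /(congr1 val) /=.
  exact: val_inj.
have t0 : (0 < t)%N by rewrite /t; lia.
have := exalg_counterexample K s f12 f_inj t0.
rewrite card_ord.
have -> : (t + s + 1 = d.+1)%N by rewrite /s /t; lia.
have -> // : (t + s + t + p = h)%N by rewrite /s /p /t; lia.
Qed.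

Theorem theorem3 (K : closedFieldType) (charK0 : [pchar K] =i pred0)
    (h1 h2 h3 : nat)
    (hO : gorenstein_Oseq K [:: 1; h1; h2; h3; 1]%N)
    (h12 : (h1 <= h2)%N) :
  (forall (A : comFalgType K) (m : {vspace A}),
      artinian_local A -> is_maximal_ideal m -> gorenstein m ->
      hilbert_function m [:: 1; h1; h2; h3; 1]%N ->
      canonically_graded m)
  <-> (h1 = h3 /\ h2 = 'C(h1.+1, 2)).
Proof.
split=> [cg|[h13 h2E] A m artA mM gor hf].
  (* The O-sequence hypothesis provides one algebra with this Hilbert function, which by assumption
     has a grading; this gives h1 = h3 and the upper bound on h2. *)
  have [/and4P[_ h1_gt0 _ _] _ [A [m [artA mM gor hf]]]] := hO.
  have [mI _ _] := mM; have [P5 _ _ _ _] := hilb4_dims mM hf.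
  have [B gB] := canonically_graded_grading mI (one_notin mM) (residue mM hf) P5
    (cg A m artA mM gor hf).
  have h13 : h1 = h3 := grading_symmetric mM gor hf gB.
  split=> //; apply/eqP; rewrite eqn_leq (h2_le mM hf) leqNgt /=.
  apply/negP => h2_lt.
  have [A' [m' [artA' mM' gor' hf' []]]] := noncanonical_example K h12 h1_gt0 h2_lt.
  by apply: cg => //; rewrite -h13.
have [P5 _ _ _ _] := hilb4_dims mM hf.
have char3 : 3%:R != 0 :> K by rewrite ((pcharf0P K).1 charK0).
have [B gB] := compressed_grading mM gor hf h13 h2E char3.
exact: (grading_canonically_graded P5 gB).
Qed.
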